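(* For all integers $k\ge 2$ and $r\ge 1$ with $k+r\ge 4$ and every $\alpha>0$, there is $\epsilon>0$ such that the following holds. Suppose $H$ is a $k$-graph on $n$ vertices with $$\delta_{k-1}(H)\ge \left(1-\binom{k+r-2}{k-1}^{-1}+\alpha\right)n$$ and $p=p(n)\ge n^{-\binom{k+r-2}{k-1}^{-1}-\epsilon}$. Then asymptotically almost surely (as $n\to\infty$) the union $H\cup\mathbb{G}^{(k)}(n,p)$ contains the $r$th power of a tight Hamilton cycle.
   Context: A $k$-graph $H=(V,E)$ is a $k$-uniform hypergraph: a finite vertex set $V$ and an edge set $E\subseteq\binom{V}{k}$. The minimum codegree $\delta_{k-1}(H)$ is the minimum, over all $(k-1)$-subsets $S\subseteq V$, of the number of vertices $v$ with $S\cup\{v\}\in E$. $\mathbb{G}^{(k)}(n,p)$ is the binomial random $k$-graph on $n$ vertices, in which each $k$-subset of vertices is an edge independently with probability $p\in[0,1]$; here it is taken on the same vertex set as $H$, and the union has as edge set the union of the edge sets. An event holds asymptotically almost surely (a.a.s.) if its probability tends to $1$ as $n\to\infty$; here $H=H_n$ is any sequence of $k$-graphs satisfying the degree condition. The $r$th power of a ($k$-uniform) tight cycle is a $k$-graph whose vertices can be ordered cyclically so that every $k+r-1$ consecutive vertices span a complete $k$-graph $K^{(k)}_{k+r-1}$ and there are no edges other than those forced by this condition. A $k$-graph on $n$ vertices contains the $r$th power of a tight Hamilton cycle if it contains, as a (not necessarily induced) spanning subgraph, the $r$th power of a tight cycle on $n$ vertices. *)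

(* Defs.v *)
From mathcomp Require Import all_boot all_order all_algebra all_fingroup.
From mathcomp Require Import reals.

Set Implicit Arguments.
Unset Strict Implicit.
Unset Printing Implicit Defensive.

Import Order.TTheory GRing.Theory Num.Theory.

Local Open Scope ring_scope.

(* A hypergraph on a finite vertex set V is represented by its edge set,
   of type {set {set V}}. *)

Definition kgraph (V : finType) (k : nat) (E : {set {set V}}) : bool :=
  [forall e in E, #|e| == k].

Definition codegree (V : finType) (E : {set {set V}}) (S : {set V}) : nat :=
  #|[set v | v |: S \in E]|.

(* A codegree is at most #|V|, so the index #|V| does not affect the minimum;
   it is only the value taken when V has no subset of size k - 1. *)
Definition min_codegree (V : finType) (k : nat) (E : {set {set V}}) : nat :=
  \big[minn/#|V|]_(S : {set V} | #|S| == k.-1) codegree E S.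

(* Probability, in the binomial random k-graph on V with edge probability p,
   of the event A: the k-graph G occurs with probability the product of p over
   the k-sets that are edges and of 1 - p over the k-sets that are not. *)
Definition binomial_kgraph_prob (R : realType) (V : finType) (k : nat) (p : R)
    (A : pred {set {set V}}) : R :=
  \sum_(G : {set {set V}} | kgraph k G && A G)
    \prod_(e : {set V} | #|e| == k) (if e \in G then p else 1 - p).

(* The m vertices at positions i, i + 1, ..., i + m - 1 (mod n) when the
   vertices are ordered cyclically as s 0, ..., s (n - 1). *)
Definition consecutive (n : nat) (s : {perm 'I_n}) (m : nat) (i : 'I_n) :
    {set 'I_n} :=
  [set s (iter t (@ordS n) i) | t : 'I_m].

Definition tight_cycle_power (n k r : nat) (C : {set {set 'I_n}}) : bool :=
  [exists s : {perm 'I_n},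
    C == [set e : {set 'I_n} |
           (#|e| == k) &&
           [exists i : 'I_n, e \subset consecutive s (k + r - 1) i]]].

Definition has_tight_Hamilton_cycle_power (n k r : nat)
    (E : {set {set 'I_n}}) : bool :=
  [exists C : {set {set 'I_n}}, tight_cycle_power k r C && (C \subset E)].

(* Main.v *)
Require Import Defs.
From mathcomp Require Import all_boot all_order all_algebra all_fingroup.
From mathcomp Require Import all_classical all_reals all_analysis.
From mathcomp Require Import zify ring lra.

Set Implicit Arguments.
Unset Strict Implicit.
Unset Printing Implicit Defensive.

Import Order.TTheory GRing.Theory Num.Theory.
Import numFieldNormedType.Exports.

Local Open Scope ring_scope.

(** The proof puts on the cyclic orders of the vertices a probability measure
under which the edges missing from [H] are so spread out that random edges of
density [n ^ (- 1/C - eps)] supply them all; here [s = k + r - 2] and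
[C = 'C(s, k - 1)], the number of edges that a vertex closes with the [s]
vertices before it.

The measure. By the codegree condition, any [s] vertices have at least
[C * alpha * n] common neighbours in [H] ([card_common_neighbours]). Call every
[L]-th position special, for a large constant [L]. First fill the special
positions and the [s] positions before each of them in increasing order, always
with a random unused vertex, and at a special position with a random unused
common neighbour of the [s] preceding vertices; then fill the rest uniformly.
Since every choice is among linearly many vertices, prescribing the vertices at
[j] positions has probability at most [(K / n) ^ j] ([random_bijection]).

Its spread. The edges whose last vertex is special lie in [H]. So a set of
missing edges that is connected and spans [v] vertices has at most
[(C - delta) * (v - 1)] edges, with a constant [delta > 0]: the first vertex
closes no edge, which gives [C * (v - 1)], a special vertex closes none either,
and a vertex after a gap closes fewer than [C] ([density_gap]). A connected set
on [v] vertices can be placed in at most [n * B ^ (v - 1)] ways, whence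
probability at most [K'' ^ v * n ^ (- (v - 1))]. Thus a set [S] of missing edges
appears with probability at most [q ^ #|S|] where [q] has the order of
[n ^ (- 1 / (C - delta))] ([edge_spread]). This is polynomially smaller than [p].

From spread to containment. If a random family of sets is [q]-spread and [p]
exceeds [q] by a power of [n], then a [p]-random set contains a member of the
family with probability tending to 1 ([spread_cover]). The argument exposes
the random set in boundedly many rounds. After a round [W], a member [Z] is
replaced by its minimum fragment, the smallest [Z' :\: W] over the members
[Z'] contained in [W :|: Z]. Fragments are subsets of the original members, so
the family remains spread; and by a double counting due to Park and Pham they
are, with few exceptions, smaller by a power of [n]
([mean_fragment_moment]). *)

(** * Random subsets with independent elements *)

Lemma set_ind (X : finType) (P : {set X} -> Prop) :
  P finset.set0 -> (forall x (D : {set X}), x \notin D -> P D -> P (x |: D)) ->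
  forall D, P D.
Proof.
move=> P0 PU D; have [m] := ubnP #|D|; elim: m D => // m IH D Dm.
have [->//|[x xD]] := set_0Vmem D.
rewrite -(finset.setD1K xD); apply: PU; first by rewrite in_setD1 eqxx.
by apply: IH; rewrite (cardsD1 x D) xD in Dm.
Qed.

Lemma sum_powersetU1 (R : realType) (X : finType) (D : {set X}) (x : X)
    (F : {set X} -> R) :
  x \notin D ->
  \sum_(G : {set X} | G \subset x |: D) F G =
  \sum_(G : {set X} | G \subset D) F (x |: G) +
  \sum_(G : {set X} | G \subset D) F G.
Proof.
move=> xD; rewrite (bigID (fun G : {set X} => x \in G)) /=; congr (_ + _).
  rewrite (reindex_onto (fun G => x |: G) (fun G => G :\ x)) /=; last first.
    by move=> G /andP[_ xG]; rewrite finset.setD1K.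
  apply: eq_bigl => G.
  rewrite setU11 andbT; apply/andP/idP => [[GD /eqP GE]|GD].
    apply/fintype.subsetP => y yG; have: y \in x |: D.
      by apply: (fintype.subsetP GD); rewrite in_setU1 yG orbT.
    rewrite in_setU1 => /orP[/eqP yx|//].
    by move: yG; rewrite -GE yx in_setD1 eqxx.
  split; first exact: finset.setUS.
  apply/eqP; rewrite setU1K //; apply: contra xD; exact: (fintype.subsetP GD).
apply: eq_bigl => G; apply/andP/idP => [[GD xG]|GD].
  apply/fintype.subsetP => y yG; have := fintype.subsetP GD y yG.
  by rewrite in_setU1 => /orP[/eqP yx|//]; rewrite -yx yG in xG.
split; first exact: (fintype.subset_trans GD (finset.subsetUr _ _)).
by apply: contra xD; exact: (fintype.subsetP GD).
Qed.

Definition bernoulli_weight (R : realType) (X : finType) (D : {set X}) (p : R)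
    (G : {set X}) : R :=
  \prod_(x in D) (if x \in G then p else 1 - p).

Definition bernoulli_mean (R : realType) (X : finType) (D : {set X}) (p : R)
    (F : {set X} -> R) : R :=
  \sum_(G : {set X} | G \subset D) bernoulli_weight D p G * F G.

Lemma bernoulli_weight_ge0 (R : realType) (X : finType) (D : {set X}) (p : R)
    (G : {set X}) :
  0 <= p <= 1 -> 0 <= bernoulli_weight D p G.
Proof.
move=> /andP[p0 p1]; apply: prodr_ge0 => x _; case: ifP => // _.
by rewrite subr_ge0.
Qed.

Lemma bernoulli_mean_le (R : realType) (X : finType) (D : {set X}) (p : R)
    (F1 F2 : {set X} -> R) :
  0 <= p <= 1 -> (forall G : {set X}, G \subset D -> F1 G <= F2 G) ->
  bernoulli_mean D p F1 <= bernoulli_mean D p F2.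
Proof.
move=> hp hF; apply: ler_sum => G GD; apply: ler_wpM2l; last exact: hF.
exact: bernoulli_weight_ge0.
Qed.

Lemma eq_bernoulli_mean (R : realType) (X : finType) (D : {set X}) (p : R)
    (F1 F2 : {set X} -> R) :
  (forall G : {set X}, G \subset D -> F1 G = F2 G) ->
  bernoulli_mean D p F1 = bernoulli_mean D p F2.
Proof. by move=> hF; apply: eq_bigr => G GD; rewrite hF. Qed.

Lemma bernoulli_meanD (R : realType) (X : finType) (D : {set X}) (p : R)
    (F1 F2 : {set X} -> R) :
  bernoulli_mean D p (fun G => F1 G + F2 G) =
  bernoulli_mean D p F1 + bernoulli_mean D p F2.
Proof. by rewrite -big_split; apply: eq_bigr => G _; rewrite mulrDr. Qed.

Lemma bernoulli_meanZ (R : realType) (X : finType) (D : {set X}) (p a : R)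
    (F : {set X} -> R) :
  bernoulli_mean D p (fun G => a * F G) = a * bernoulli_mean D p F.
Proof. by rewrite mulr_sumr; apply: eq_bigr => G _; rewrite mulrCA. Qed.

Lemma bernoulli_mean0 (R : realType) (X : finType) (p : R)
    (F : {set X} -> R) :
  bernoulli_mean finset.set0 p F = F finset.set0.
Proof.
rewrite /bernoulli_mean (big_pred1 finset.set0) => [|G]; last first.
  by rewrite finset.subset0.
by rewrite /bernoulli_weight finset.big_set0 mul1r.
Qed.

Lemma bernoulli_meanU1 (R : realType) (X : finType) (D : {set X}) (p : R)
    (x : X) (F : {set X} -> R) :
  x \notin D ->
  bernoulli_mean (x |: D) p F =
  p * bernoulli_mean D p (fun G => F (x |: G)) + (1 - p) * bernoulli_mean D p F.
Proof.
move=> xD; rewrite /bernoulli_mean sum_powersetU1 // !mulr_sumr.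
congr (_ + _); apply: eq_bigr => G GD; rewrite mulrA; congr (_ * _);
  rewrite /bernoulli_weight big_setU1 //=.
  rewrite setU11; congr (_ * _); apply: eq_bigr => y yD; rewrite in_setU1.
  by case: eqVneq => // yx; rewrite yx (negbTE xD) in yD.
by rewrite ifN //; apply: contra xD; exact: (fintype.subsetP GD).
Qed.

Lemma bernoulli_mean_cst (R : realType) (X : finType) (D : {set X}) (p a : R) :
  bernoulli_mean D p (fun=> a) = a.
Proof.
elim/set_ind: D => [|x D xD IH]; first by rewrite bernoulli_mean0.
by rewrite bernoulli_meanU1 // IH; ring.
Qed.

(** An element is missed by the union exactly when both independent random sets
miss it. *)
Lemma bernoulli_mean_union (R : realType) (X : finType) (D : {set X})
    (p1 p2 : R) (F : {set X} -> R) :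
  bernoulli_mean D p1 (fun G1 => bernoulli_mean D p2 (fun G2 => F (G1 :|: G2)))
  = bernoulli_mean D (1 - (1 - p1) * (1 - p2)) F.
Proof.
elim/set_ind: D F => [|x D xD IH] F; first by rewrite !bernoulli_mean0 finset.setU0.
have inner (G1 : {set X}) :
    bernoulli_mean (x |: D) p2 (fun G2 => F (G1 :|: G2)) =
    p2 * bernoulli_mean D p2 (fun G2 => F (x |: (G1 :|: G2))) +
    (1 - p2) * bernoulli_mean D p2 (fun G2 => F (G1 :|: G2)).
  rewrite bernoulli_meanU1 //; congr (_ * _ + _).
  by apply: eq_bernoulli_mean => G2 _; rewrite finset.setUCA.
have innerx (G1 : {set X}) :
    bernoulli_mean (x |: D) p2 (fun G2 => F ((x |: G1) :|: G2)) =
    bernoulli_mean D p2 (fun G2 => F (x |: (G1 :|: G2))).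
  rewrite inner; set M := RHS.
  have -> : bernoulli_mean D p2 (fun G2 => F ((x |: G1) :|: G2)) = M.
    by apply: eq_bernoulli_mean => G2 _; rewrite finset.setUA.
  have -> : bernoulli_mean D p2 (fun G2 => F (x |: ((x |: G1) :|: G2))) = M.
    by apply: eq_bernoulli_mean => G2 _; rewrite !finset.setUA finset.setUid.
  ring.
rewrite !bernoulli_meanU1 //.
rewrite (eq_bernoulli_mean _ (fun G _ => innerx G)).
rewrite (eq_bernoulli_mean _ (fun G _ => inner G)).
rewrite bernoulli_meanD !bernoulli_meanZ (IH (fun G => F (x |: G))) (IH F).
ring.
Qed.

(** A denser random set is the union of a sparser one and an independent one, so
it can only be better for a decreasing [F]. *)
Lemma bernoulli_mean_mono (R : realType) (X : finType) (D : {set X})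
    (p1 p2 : R) (F : {set X} -> R) :
  0 <= p1 <= p2 -> p2 <= 1 ->
  (forall G G' : {set X}, G \subset G' -> F G' <= F G) ->
  bernoulli_mean D p2 F <= bernoulli_mean D p1 F.
Proof.
move=> /andP[p10 p12] p21 Fmono.
have p1b : 0 <= p1 <= 1 by rewrite p10 (le_trans p12).
have [p1E|p1N] := eqVneq p1 1.
  by have -> : p2 = p1 by apply/le_anti; rewrite p12 p1E p21.
have lt1 : 0 < 1 - p1 by rewrite subr_gt0 lt_neqAle p1N; case/andP: p1b.
have -> : p2 = 1 - (1 - p1) * (1 - (p2 - p1) / (1 - p1)).
  by field; rewrite gt_eqF.
rewrite -bernoulli_mean_union; apply: bernoulli_mean_le => // G _.
rewrite -[leRHS](bernoulli_mean_cst D ((p2 - p1) / (1 - p1)) (F G)).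
apply: bernoulli_mean_le => [|G' _]; last exact/Fmono/finset.subsetUl.
rewrite divr_ge0 ?subr_ge0 ?(ltW lt1) //=; last by case/andP: p1b.
by rewrite ler_pdivrMr // mul1r lerB.
Qed.

(** Turning the elements of [T] from absent to present replaces factors
[1 - p <= 1] by factors [p]. *)
Lemma bernoulli_weight_setU (R : realType) (X : finType) (D T W : {set X})
    (p : R) :
  0 <= p <= 1 -> T \subset D -> [disjoint W & T] ->
  bernoulli_weight D p W * p ^+ #|T| <= bernoulli_weight D p (W :|: T).
Proof.
move=> /andP[p0 p1] TD dis.
rewrite /bernoulli_weight (finset.big_setID T) /= [leRHS](finset.big_setID T) /=.
rewrite (finset.setIidPr TD) mulrAC; apply: ler_pM.
- apply: mulr_ge0; last exact: exprn_ge0.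
  by apply: prodr_ge0 => x _; case: ifP => // _; rewrite subr_ge0.
- by apply: prodr_ge0 => x _; case: ifP => // _; rewrite subr_ge0.
- rewrite -prodr_const -big_split /=; apply: ler_prod => x xT.
  rewrite finset.in_setU xT orbT; case: ifP => xW.
    by move: dis; rewrite disjoint_sym => /disjointFr /(_ xT); rewrite xW.
  by rewrite mulr_ge0 ?subr_ge0 //= ler_piMl // lerBlDr lerDl.
apply: ler_prod => x; rewrite finset.in_setD => /andP[xT _].
rewrite finset.in_setU (negbTE xT) orbF lexx andbT.
by case: ifP => // _; rewrite subr_ge0.
Qed.

Lemma sum_powerset_expr (R : realType) (X : finType) (S : {set X}) (a : R) :
  \sum_(T : {set X} | T \subset S) a ^+ #|T| = (1 + a) ^+ #|S|.
Proof.
elim/set_ind: S => [|x D xD IH].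
  by rewrite (big_pred1 finset.set0) ?cards0 ?expr0 // => G; rewrite finset.subset0.
rewrite sum_powersetU1 // cardsU1 xD exprD expr1 -IH mulrDl mul1r addrC.
congr (_ + _); rewrite mulr_sumr; apply: eq_bigr => G GD.
rewrite cardsU1 (contra _ xD) ?exprS //; exact: (fintype.subsetP GD).
Qed.

(** * Minimum fragments and the spread lemma *)

(** The minimum fragment of [Z i] with respect to [W]: what [W] leaves of the
member inside [W :|: Z i] that [W] covers best. *)
Definition fragment (X I : finType) (A : {set I}) (Z : I -> {set X})
    (W : {set X}) (i : I) : {set X} :=
  Z [arg min_(j < i | (j \in A) && (Z j \subset W :|: Z i)) #|Z j :\: W|]
    :\: W.

(** The last property is the crucial one: any member [Z j] inside [W :|: T]
competes in the minimum, and [Z j :\: W] is a subset of [T], hence equal to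
it. *)
Lemma fragmentP (X I : finType) (A : {set I}) (Z : I -> {set X})
    (W : {set X}) (i : I) (T := fragment A Z W i) :
  i \in A ->
  [/\ T \subset Z i, W :&: T = finset.set0,
      exists2 j, j \in A & Z j \subset W :|: T &
      forall j, j \in A -> Z j \subset W :|: T -> T \subset Z j].
Proof.
move=> iA; rewrite {}/T /fragment; case: arg_minnP => [|j /andP[jA jW] jmin].
  by rewrite iA finset.subsetUr.
have TZ : Z j :\: W \subset Z i by rewrite finset.subDset.
split=> //.
- by rewrite finset.setIDA finset.setIC finset.setDIl finset.setDv finset.setI0.
- by exists j => //; rewrite -finset.subDset.
move=> m mA mW.
have sub : Z m :\: W \subset Z j :\: W by rewrite finset.subDset.
have /eqP <- : Z m :\: W == Z j :\: W.
  rewrite eqEcard sub jmin // mA (fintype.subset_trans mW) //.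
  exact: finset.setUS.
exact: finset.subsetDl.
Qed.

(** Minimum fragments are cheap to describe. Fix [Y = W :|: T], where [T] is the
fragment of [W] at [i]. Some member of the family lies in [Y], and by
minimality [T] is contained in every such member; so, once [Y] is known, [T] is
one of the subsets of a single member. Replacing [W] by [Y] costs a factor
[p ^- #|T|], and spreadness gains the factor [q ^+ #|T|]. *)
Lemma mean_fragment_moment (R : realType) (X I : finType) (D : {set X})
    (A : {set I}) (Z : I -> {set X}) (mu : I -> R) (p q lam : R) (l : nat) :
  0 < p <= 1 -> 0 <= q -> 0 <= lam -> (forall i, 0 <= mu i) ->
  (forall i, i \in A -> Z i \subset D) ->
  (forall i, i \in A -> (#|Z i| <= l)%N) ->
  (forall S : {set X}, \sum_(i in A | S \subset Z i) mu i <= q ^+ #|S|) ->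
  bernoulli_mean D p
    (fun W => \sum_(i in A) mu i * lam ^+ #|fragment A Z W i|)
  <= (1 + lam * q / p) ^+ l.
Proof.
move=> /andP[p0 p1] q0 lam0 mu0 ZD Zl spread.
have pb : 0 <= p <= 1 by rewrite ltW.
pose a := lam / p; have a0 : 0 <= a by rewrite divr_ge0 // ltW.
(* A member inside Y that depends on Y only; it contains every fragment T with
   W :|: T = Y. *)
pose member (Y : {set X}) :=
  if [pick j in A | Z j \subset Y] is Some j then Z j else finset.set0.
have memberl Y : (#|member Y| <= l)%N.
  by rewrite /member; case: pickP => [j /andP[/Zl ->]|_] //; rewrite cards0.
have wt0 Y : 0 <= bernoulli_weight D p Y by exact: bernoulli_weight_ge0.
have step1 : bernoulli_mean D p
    (fun W => \sum_(i in A) mu i * lam ^+ #|fragment A Z W i|)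
  <= \sum_(W : {set X} | W \subset D) \sum_(i in A)
       mu i * (bernoulli_weight D p (W :|: fragment A Z W i)
               * a ^+ #|fragment A Z W i|).
  apply: ler_sum => W WD; rewrite mulr_sumr; apply: ler_sum => i iA.
  have [TZ TW _ _] := @fragmentP _ _ A Z W i iA.
  rewrite mulrCA; apply: ler_wpM2l => //.
  set T := fragment A Z W i in TZ TW *.
  have TD : T \subset D by exact: fintype.subset_trans (ZD _ iA).
  rewrite /a expr_div_n mulrA ler_pdivlMr ?exprn_gt0 // mulrAC.
  apply: ler_wpM2r; first exact: exprn_ge0.
  by apply: bernoulli_weight_setU => //; rewrite -setI_eq0 TW.
apply: (le_trans step1).
have step2 (i : I) (T : {set X}) : i \in A ->
  \sum_(W : {set X} | (W \subset D) && (fragment A Z W i == T))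
     bernoulli_weight D p (W :|: T)
  <= \sum_(Y : {set X} | Y \subset D)
      (if (T \subset member Y) && (T \subset Z i) then bernoulli_weight D p Y
       else 0).
  move=> iA.
  rewrite (reindex_onto (fun Y => Y :\: T) (fun W => W :|: T)) /=; last first.
    move=> W /andP[_ /eqP TE]; have [_ TW _ _] := @fragmentP _ _ A Z W i iA.
    rewrite TE in TW; apply/setP => x; rewrite !inE.
    by have /setP/(_ x) := TW; rewrite !inE; case: (x \in T); case: (x \in W).
  rewrite big_mkcond [leRHS]big_mkcond; apply: ler_sum => Y _ /=.
  case: ifP => [/andP[/andP[YD /eqP TE] /eqP YE]|_]; last first.
    by case: ifP => // _; case: ifP.
  have [TZ _ [j jA jY] Tmin] := @fragmentP _ _ A Z (Y :\: T) i iA.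
  rewrite TE YE in TZ jY Tmin.
  have YD' : Y \subset D.
    by rewrite -YE finset.subUset YD (fintype.subset_trans TZ) ?ZD.
  rewrite YD' TZ andbT YE ifT // /member; case: pickP => [m /andP[mA mY]|].
    exact: Tmin.
  by move/(_ j); rewrite /= jA jY.
have step3 : \sum_(W : {set X} | W \subset D) \sum_(i in A)
       mu i * (bernoulli_weight D p (W :|: fragment A Z W i)
               * a ^+ #|fragment A Z W i|)
  <= \sum_(i in A) \sum_(T : {set X}) mu i * a ^+ #|T| *
       \sum_(Y : {set X} | Y \subset D)
      (if (T \subset member Y) && (T \subset Z i) then bernoulli_weight D p Y
       else 0).
  rewrite exchange_big /=; apply: ler_sum => i iA.
  rewrite (partition_big (fun W => fragment A Z W i) predT) //=.
  apply: ler_sum => T _.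
  apply: le_trans (ler_wpM2l _ (step2 i T iA)); last first.
    by rewrite mulr_ge0 ?exprn_ge0.
  rewrite mulr_sumr; apply: ler_sum => W /andP[_ /eqP ->].
  by rewrite mulrCA mulrC.
apply: (le_trans step3).
have -> : \sum_(i in A) \sum_(T : {set X}) mu i * a ^+ #|T| *
       \sum_(Y : {set X} | Y \subset D)
      (if (T \subset member Y) && (T \subset Z i) then bernoulli_weight D p Y
       else 0) =
  bernoulli_mean D p (fun Y => \sum_(T : {set X} | T \subset member Y)
    a ^+ #|T| * \sum_(i in A | T \subset Z i) mu i).
  under eq_bigr => i _ do under eq_bigr => T _ do rewrite mulr_sumr.
  under eq_bigr => i _ do rewrite exchange_big.
  rewrite exchange_big /=; apply: eq_bigr => Y YD.
  rewrite exchange_big mulr_sumr [RHS]big_mkcond /=; apply: eq_bigr => T _.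
  case: ifP => /= TY; last by rewrite big1 // => i _; rewrite mulr0.
  rewrite mulrA mulr_sumr [RHS]big_mkcondr /=.
  apply: eq_bigr => i _; case: ifP => _; last by rewrite mulr0.
  by rewrite mulrC mulrA mulrAC.
rewrite -[leRHS](bernoulli_mean_cst D p); apply: bernoulli_mean_le => // Y _.
apply: (@le_trans _ _ (\sum_(T : {set X} | T \subset member Y) (a * q) ^+ #|T|)).
  apply: ler_sum => T _; rewrite [leRHS]exprMn; apply: ler_wpM2l => //.
  exact: exprn_ge0.
have aq0 : 0 <= a * q by rewrite mulr_ge0.
rewrite sum_powerset_expr mulrAC -/a; apply: ler_weXn2l => //.
by rewrite lerDl mulrAC.
Qed.

(** Markov's inequality for the exponential moment of the fragment size, with
base [lam = y / (q / p)]. The moment is at most [expR (l * y)], and a fragment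
larger than [l * y] contributes at least [expR (l * y) * (lam / expR 1)]. *)
Lemma mean_large_fragment (R : realType) (X I : finType) (D : {set X})
    (A : {set I}) (Z : I -> {set X}) (mu : I -> R) (p q y l : R) :
  0 < p <= 1 -> 0 < q -> 0 <= l -> expR 1 * (q / p) <= y ->
  (forall i, 0 <= mu i) ->
  (forall i, i \in A -> Z i \subset D) ->
  (forall i, i \in A -> #|Z i|%:R <= l) ->
  (forall S : {set X}, \sum_(i in A | S \subset Z i) mu i <= q ^+ #|S|) ->
  bernoulli_mean D p
    (fun W => \sum_(i in A | ~~ (#|fragment A Z W i|%:R <= l * y)) mu i)
  <= expR 1 * (q / p) / y.
Proof.
move=> pp q0 l0 xy mu0 ZD Zl spread.
have /andP[p0 p1] := pp; have pb : 0 <= p <= 1 by rewrite ltW.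
set x := q / p in xy *; have x0 : 0 < x by rewrite divr_gt0.
have e0 : 0 < expR 1 :> R by exact: expR_gt0.
have y0 : 0 < y by rewrite (lt_le_trans _ xy) // mulr_gt0.
pose lam := y / x; have lam0 : 0 < lam by rewrite divr_gt0.
have elam : 1 <= lam / expR 1.
  by rewrite ler_pdivlMr // mul1r ler_pdivlMr.
pose l' := \max_(i in A) #|Z i|.
have l'l : l'%:R <= l.
  rewrite /l'; have [->|[i iA]] := set_0Vmem A; first by rewrite finset.big_set0.
  have A0 : (0 < #|A|)%N by apply/card_gt0P; exists i.
  by have [j jA ->] := eq_bigmax_cond (fun i => #|Z i|) A0; exact: Zl.
(* c * lam ^ t >= 1 whenever t > l * y. *)
pose c := expR (- (l * y)) * (expR 1 / lam).
have c0 : 0 <= c by rewrite mulr_ge0 ?divr_ge0 ?expR_ge0 // ltW.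
apply: (@le_trans _ _ (bernoulli_mean D p
    (fun W => c * \sum_(i in A) mu i * lam ^+ #|fragment A Z W i|))).
  apply: bernoulli_mean_le => // W _.
  rewrite mulr_sumr [leLHS]big_mkcondr /=; apply: ler_sum => i iA.
  have tl0 t : 0 <= c * (mu i * lam ^+ t).
    by rewrite mulr_ge0 // mulr_ge0 // exprn_ge0 // ltW.
  case: ifP => // large.
  rewrite mulrCA ler_peMr //.
  move: large; rewrite -ltNge; set t := #|_| => large.
  have t0 : (0 < t)%N by rewrite -(ltr0n R) (le_lt_trans _ large) // mulr_ge0 // ltW.
  have -> : c * lam ^+ t = expR (t%:R - l * y) * (lam / expR 1) ^+ t.-1.
    have et : expR t%:R = expR 1 ^+ t :> R by rewrite -[t%:R]mulr1 expRM_natl.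
    rewrite /c expRD et -(prednK t0) /= !exprS (expr_div_n lam (expR 1)).
    by field; rewrite ?expf_neq0 ?gt_eqF.
  rewrite -[leLHS]mulr1; apply: ler_pM => //; last exact: exprn_ege1.
  by rewrite -[leLHS]expR0 ler_expR subr_ge0 ltW.
rewrite bernoulli_meanZ.
apply: (@le_trans _ _ (c * (1 + lam * q / p) ^+ l')).
  apply: ler_wpM2l => //; apply: mean_fragment_moment => //; try exact: ltW.
  by move=> i iA; exact: leq_bigmax_cond.
have -> : lam * q / p = y.
  by rewrite /lam -mulrA -/x divfK // gt_eqF.
have -> : expR 1 * x / y = expR 1 / lam by rewrite /lam; field; rewrite !gt_eqF.
rewrite /c mulrAC -[leRHS]mul1r; apply: ler_wpM2r.
  by rewrite divr_ge0 // ltW.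
rewrite -[leRHS](expRxMexpNx_1 (l * y)) mulrC; apply: ler_wpM2r; first exact: expR_ge0.
apply: (@le_trans _ _ (expR y ^+ l')).
  have ye : 1 + y <= expR y by exact: expR_ge1Dx.
  by apply: lerXn2r; rewrite ?nnegrE ?expR_ge0 // addr_ge0 // ltW.
by rewrite -expRM_natl ler_expR; apply: ler_wpM2r => //; exact: ltW.
Qed.

(** Each round keeps the members with a small fragment. Bounding the product of
the failure probability and the mass of the family, rather than the failure
probability alone, charges the dropped members by their measure; when
[l * y ^ t < 1] the surviving fragments are empty. *)
Lemma spread_iteration (R : realType) (X I : finType) (D : {set X})
    (mu : I -> R) (p q y : R) (t : nat) (A : {set I}) (Z : I -> {set X}) (l : R) :
  0 < p <= 1 -> 0 < q -> expR 1 * (q / p) <= y -> (forall i, 0 <= mu i) ->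
  0 <= l -> l * y ^+ t < 1 ->
  (forall i, i \in A -> Z i \subset D) ->
  (forall i, i \in A -> #|Z i|%:R <= l) ->
  (forall S : {set X}, \sum_(i in A | S \subset Z i) mu i <= q ^+ #|S|) ->
  (\sum_(i in A) mu i) *
  bernoulli_mean D (1 - (1 - p) ^+ t)
    (fun G => [forall i in A, ~~ (Z i \subset G)]%:R)
  <= t%:R * (expR 1 * (q / p) / y).
Proof.
move=> pp q0 xy mu0; have /andP[p0 p1] := pp.
have pb : 0 <= p <= 1 by rewrite ltW.
have x0 : 0 < expR 1 * (q / p) by rewrite mulr_gt0 ?expR_gt0 // divr_gt0.
have y0 : 0 < y by rewrite (lt_le_trans _ xy).
set eta := expR 1 * (q / p) / y.
elim: t A Z l => [|t IH] A Z l l0 lt1 ZD Zl spread.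
  rewrite mul0r; have [->|[i iA]] := set_0Vmem A.
    by rewrite finset.big_set0 mul0r.
  rewrite [X in _ * X](_ : _ = 0) ?mulr0 // /bernoulli_mean big1 // => G _.
  suff /negbTE -> : ~~ [forall i in A, ~~ (Z i \subset G)] by rewrite mulr0.
  apply/forallPn; exists i; rewrite iA /= negbK.
  have /eqP -> : Z i == finset.set0.
    rewrite -cards_eq0 -leqn0 -ltnS -(ltr_nat R).
    by apply: le_lt_trans lt1; rewrite mulr1 Zl.
  exact: finset.sub0set.
have -> : 1 - (1 - p) ^+ t.+1 = 1 - (1 - p) * (1 - (1 - (1 - p) ^+ t)).
  by rewrite exprS; ring.
rewrite -bernoulli_mean_union -bernoulli_meanZ.
pose A' W := [set i in A | #|fragment A Z W i|%:R <= l * y].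
have qb : 0 <= 1 - (1 - p) ^+ t <= 1.
  have h : 0 <= 1 - p <= 1 by rewrite subr_ge0 p1 lerBlDr lerDl ltW.
  rewrite subr_ge0 lerBlDr lerDl exprn_ge0 ?exprn_ile1 //; by case/andP: h.
have key (W : {set X}) : W \subset D ->
  (\sum_(i in A) mu i) * bernoulli_mean D (1 - (1 - p) ^+ t)
     (fun G => [forall i in A, ~~ (Z i \subset W :|: G)]%:R) <=
  t%:R * eta + \sum_(i in A | ~~ (#|fragment A Z W i|%:R <= l * y)) mu i.
  move=> WD; set P := bernoulli_mean _ _ _.
  have P01 : 0 <= P <= 1.
    rewrite /P; apply/andP; split.
      by apply: sumr_ge0 => G _; rewrite mulr_ge0 ?bernoulli_weight_ge0.
    rewrite -[leRHS](bernoulli_mean_cst D (1 - (1 - p) ^+ t)).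
    by apply: bernoulli_mean_le => // G _; rewrite lern1 leq_b1.
  have /andP[P0 P1] := P01.
  rewrite (bigID (fun i => #|fragment A Z W i|%:R <= l * y)) /= mulrDl.
  apply: lerD; last first.
    by rewrite -[leRHS]mulr1; apply: ler_wpM2l => //; exact: sumr_ge0.
  rewrite [X in X * _](_ : _ = \sum_(i in A' W) mu i); last first.
    by apply: eq_bigl => i; rewrite inE.
  apply: (le_trans _ (IH (A' W) (fragment A Z W) (l * y) _ _ _ _ _)).
  - apply: ler_wpM2l; first exact: sumr_ge0.
    apply: bernoulli_mean_le => // G GD; rewrite ler_nat.
    case E : [forall _ in A, _] => //=; rewrite lt0b.
    apply/forall_inP => i; rewrite inE => /andP[iA _]; apply/negP => sub.
    have [_ _ [j jA jW] _] := @fragmentP _ _ A Z W i iA.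
    move/forall_inP/(_ j jA)/negP: E; apply.
    exact: fintype.subset_trans (finset.setUS _ sub).
  - by rewrite mulr_ge0 // ltW.
  - by rewrite -mulrA -exprS.
  - move=> i; rewrite inE => /andP[iA _].
    have [TZ _ _ _] := @fragmentP _ _ A Z W i iA.
    exact: fintype.subset_trans TZ (ZD _ iA).
  - by move=> i; rewrite inE => /andP[].
  move=> S; apply: le_trans (spread S).
  rewrite big_mkcond [leRHS]big_mkcond /=; apply: ler_sum => i _.
  rewrite inE; case: ifP => [/andP[/andP[iA _] SZ]|_]; last by case: ifP.
  have [TZ _ _ _] := @fragmentP _ _ A Z W i iA.
  by rewrite iA (fintype.subset_trans SZ TZ).
apply: (@le_trans _ _ (t%:R * eta + eta)); last by rewrite -natr1 mulrDl mul1r.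
apply: (le_trans (bernoulli_mean_le pb key)).
rewrite bernoulli_meanD bernoulli_mean_cst lerD2l.
exact: mean_large_fragment.
Qed.

(** A weak form of the spread lemma of Frankston, Kahn, Narayanan and Park, for
[p] larger than [q] by a polynomial factor: the random set contains the union
of [t] independent ones of density [p / t], and each of these shrinks the
family by the factor [y]. *)
Lemma spread_cover (R : realType) (X I : finType) (D : {set X})
    (mu : I -> R) (p q y : R) (t : nat) (A : {set I}) (Z : I -> {set X}) (l : R) :
  (0 < t)%N ->
  0 < p <= 1 -> 0 < q -> expR 1 * (t%:R * q / p) <= y -> (forall i, 0 <= mu i) ->
  \sum_(i in A) mu i = 1 ->
  0 <= l -> l * y ^+ t < 1 ->
  (forall i, i \in A -> Z i \subset D) ->
  (forall i, i \in A -> #|Z i|%:R <= l) ->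
  (forall S : {set X}, \sum_(i in A | S \subset Z i) mu i <= q ^+ #|S|) ->
  bernoulli_mean D p (fun G => [forall i in A, ~~ (Z i \subset G)]%:R)
  <= t%:R * (expR 1 * (t%:R * q / p) / y).
Proof.
move=> t0 /andP[p0 p1] q0 xy mu0 mu1 l0 lt1 ZD Zl spread.
have tR : 0 < t%:R :> R by rewrite ltr0n.
have t1 : 1 <= t%:R :> R by rewrite ler1n.
have pt : 0 < p / t%:R <= 1.
  by rewrite divr_gt0 //= ler_pdivrMr // mul1r (le_trans p1).
have E : q / (p / t%:R) = t%:R * q / p by field; rewrite ?gt_eqF.
have := @spread_iteration R X I D mu (p / t%:R) q y t A Z l.
rewrite E mu1 mul1r => /(_ pt q0 xy mu0 l0 lt1 ZD Zl spread).
apply: le_trans; apply: bernoulli_mean_mono => //; last first.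
  move=> G G' sub; rewrite ler_nat; case E' : [forall _ in _, _] => //=.
  rewrite lt0b; apply/forall_inP => i iA.
  move/forall_inP/(_ i iA): E'; apply: contra => s.
  exact: fintype.subset_trans sub.
have /andP[pt0 pt1] := pt.
have h0 : 0 <= 1 - p / t%:R by rewrite subr_ge0.
apply/andP; split.
  by rewrite subr_ge0 exprn_ile1 // lerBlDr lerDl ltW.
have bern m : 1 - m%:R * (p / t%:R) <= (1 - p / t%:R) ^+ m.
  elim: m => [|m IHm]; first by rewrite mul0r subr0.
  rewrite exprS; apply: le_trans (ler_wpM2l h0 IHm).
  have : 0 <= m%:R * (p / t%:R) ^+ 2 by rewrite mulr_ge0 ?sqr_ge0.
  by rewrite -natr1; move: (p / t%:R) => a; lra.
by have := bern t; rewrite mulrC divfK ?gt_eqF // => h; lra.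
Qed.

(** * Random bijections with constraints *)

Definition agree_on (n : nat) (P : {set 'I_n}) (s0 s : {perm 'I_n}) : bool :=
  [forall i in P, s i == s0 i].

Lemma agree_onP (n : nat) (P : {set 'I_n}) (s0 s : {perm 'I_n}) :
  reflect (forall i, i \in P -> s i = s0 i) (agree_on P s0 s).
Proof.
by apply: (iffP forall_inP) => h i iP; [exact/eqP/h|rewrite h].
Qed.

Lemma card_agree_on (n : nat) (P : {set 'I_n}) (s0 : {perm 'I_n}) :
  #|[set s | agree_on P s0 s]| = (n - #|P|)`!.
Proof.
have <- : #|~: P| = (n - #|P|)%N by rewrite cardsCs card_ord finset.setCK.
rewrite -card_perm -(card_imset _ (@mulIg _ s0^-1)%g); apply: eq_card => u.
apply/imsetP/idP => [[s + ->]|uP].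
  rewrite inE => /agree_onP h; apply/fintype.subsetP => i; rewrite inE permM.
  by rewrite finset.in_setC; apply: contra => /h ->; rewrite permK.
exists (u * s0)%g; last by rewrite mulgK.
rewrite inE; apply/agree_onP => i iP; rewrite permM (out_perm uP) //.
by rewrite finset.in_setC iP.
Qed.

(** This bounds [(M - j)! / M!] by [(expR 1 / M) ^ j], through
[(1 + 1 / M) ^ j <= expR (j / M) <= expR 1] in each step. *)
Lemma fact_ratio_le (R : realType) (M j : nat) :
  (j <= M)%N -> M%:R ^+ j * ((M - j)`!)%:R <= expR 1 ^+ j * (M`!)%:R :> R.
Proof.
elim: j M => [|j IH] [|M] //.
rewrite ltnS subSS => jM; rewrite !exprS factS natrM.
have [M0|M0] := posnP M.
  move: jM; rewrite M0 leqn0 => /eqP ->; rewrite !expr0 !mulr1.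
  by rewrite -[leLHS]expR0 ler_expR.
have step : M.+1%:R ^+ j <= expR 1 * M%:R ^+ j :> R.
  have MR : 0 < M%:R :> R by rewrite ltr0n.
  rewrite -ler_pdivrMr ?exprn_gt0 // -expr_div_n.
  have -> : M.+1%:R / M%:R = 1 + M%:R^-1 :> R.
    by rewrite -natr1; field; rewrite gt_eqF.
  apply: (@le_trans _ _ (expR M%:R^-1 ^+ j)).
    have h : 1 + M%:R^-1 <= expR M%:R^-1 :> R by exact: expR_ge1Dx.
    by apply: lerXn2r; rewrite ?nnegrE ?expR_ge0 // addr_ge0 // invr_ge0.
  by rewrite -expRM_natl ler_expR ler_pdivrMr // mul1r ler_nat.
have IHj := IH M jM.
apply: (@le_trans _ _ (M.+1%:R * (expR 1 * (M%:R ^+ j * ((M - j)`!)%:R)))).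
  rewrite -!mulrA; apply: ler_wpM2l => //; rewrite [leRHS]mulrA.
  exact: ler_wpM2r.
rewrite [leRHS]mulrACA mulrA [M.+1%:R * expR 1]mulrC.
by apply: ler_wpM2l => //; rewrite mulr_ge0 ?expR_ge0.
Qed.

(** The permutation [sigma] records the values chosen at the positions of [Q]
below [j]. If [j] is in [Q], its value [c] is drawn uniformly from the unused
elements of [N], of which there are at least [kap^-1], and it is recorded by
composing [sigma] with a transposition, which keeps the earlier values. Once all
of [Q] is filled, the remaining positions are filled uniformly. Each of the
positions of [P] then contributes a factor at most [kap]. *)
Lemma random_bijection_stage (R : realType) (n : nat) (Q : {set 'I_n})
    (N : 'I_n -> {perm 'I_n} -> {set 'I_n}) (kap : R) (d j : nat) :
  (forall t (s s' : {perm 'I_n}), t \in Q ->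
    (forall i, i \in Q -> (i < t)%N -> s i = s' i) -> N t s = N t s') ->
  (forall t s, t \in Q -> kap^-1 + #|Q|%:R <= #|N t s|%:R) ->
  0 < kap -> expR 1 <= kap * (n - #|Q|)%:R ->
  (j + d)%N = n ->
  forall sigma : {perm 'I_n},
  exists w : {perm 'I_n} -> R,
    [/\ forall s, 0 <= w s, \sum_s w s = 1,
        forall s, w s != 0 ->
          (forall i, i \in Q -> (i < j)%N -> s i = sigma i) /\
          (forall t, t \in Q -> (j <= t)%N -> s t \in N t s) &
        forall (P : {set 'I_n}) s0,
          (forall i, i \in P -> i \in Q -> (j <= i)%N) ->
          \sum_(s | agree_on P s0 s) w s <= kap ^+ #|P|].
Proof.
move=> Nloc Nbig kap0 kapn; elim: d j => [|d IH] j jd sigma.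
  rewrite addn0 in jd; set M := (n - #|Q|)%N in kapn.
  have fM : 0 < M`!%:R :> R by rewrite ltr0n fact_gt0.
  have M0 : 0 < M%:R :> R.
    by rewrite -(pmulr_rgt0 _ kap0) (lt_le_trans _ kapn) // expR_gt0.
  exists (fun s => if agree_on Q sigma s then (M`!%:R)^-1 else 0); split.
  - by move=> s; case: ifP => // _; rewrite invr_ge0 ltW.
  - rewrite -big_mkcond sumr_const /=.
    have -> : #|[pred s | agree_on Q sigma s]| = M`!.
      by rewrite -(card_agree_on Q sigma); apply: eq_card => s; rewrite inE.
    by rewrite -[LHS]mulr_natr mulVf // gt_eqF.
  - move=> s; case: ifP; rewrite ?eqxx // => /agree_onP ag _; split.
      by move=> i iQ _; exact: ag.
    by move=> t _; rewrite jd leqNgt ltn_ord.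
  move=> P s0 PQ; rewrite -big_mkcondr /= sumr_const.
  have [|[s1]] := set_0Vmem [set s | agree_on P s0 s && agree_on Q sigma s].
    move=> e; rewrite (_ : #|_| = 0%N) ?mulr0n ?exprn_ge0 ?ltW //.
    by rewrite -(@cards0 {perm 'I_n}) -e; apply: eq_card => s; rewrite inE.
  rewrite inE => /andP[/agree_onP s1P /agree_onP s1Q].
  have dis : [disjoint Q & P].
    rewrite disjoint_sym; apply/pred0P => i /=; apply/negbTE/negP.
    by case/andP=> iP iQ; have := PQ i iP iQ; rewrite jd leqNgt ltn_ord.
  rewrite (_ : #|_| = (M - #|P|)`!); last first.
    rewrite -subnDA -cardsUI (_ : Q :&: P = finset.set0) ?cards0 ?addn0; last first.
      by apply/eqP; rewrite setI_eq0.
    rewrite -(card_agree_on _ s1); apply: eq_card => s; rewrite !inE.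
    apply/andP/agree_onP => [[/agree_onP sP /agree_onP sQ] i|sQP].
      by rewrite finset.in_setU => /orP[iQ|iP];
        [rewrite sQ // s1Q|rewrite sP // s1P].
    split; apply/agree_onP => i iP.
      by rewrite -s1P // sQP // finset.in_setU iP orbT.
    by rewrite -s1Q // sQP // finset.in_setU iP.
  rewrite -[leLHS]mulr_natr mulrC ler_pdivrMr //.
  have PM : (#|P| <= M)%N.
    rewrite leq_subRL; last by rewrite -[leqRHS]card_ord max_card.
    have := max_card (mem (Q :|: P)); rewrite card_ord; apply: leq_trans.
    by rewrite cardsU (_ : Q :&: P = finset.set0) ?cards0 ?subn0 //; apply/eqP; rewrite setI_eq0.
  have := fact_ratio_le R PM.
  rewrite -ler_pdivlMl ?exprn_gt0 // => /le_trans; apply.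
  rewrite mulrA; apply: ler_wpM2r; first exact: ltW.
  rewrite ler_pdivrMl ?exprn_gt0 // -exprMn.
  by apply: lerXn2r; rewrite ?nnegrE ?expR_ge0 ?mulr_ge0 ?(ltW kap0) // mulrC.
have jn : (j < n)%N by rewrite -jd addnS ltnS leq_addr.
pose tj := Ordinal jn.
have jd' : (j.+1 + d)%N = n by rewrite addSnnS.
have ltS i : i \in Q -> (i < j.+1)%N -> i != tj -> (i < j)%N.
  by move=> _; rewrite ltnS leq_eqVlt => /orP[/eqP e|//]; rewrite -val_eqE /= e eqxx.
case: (boolP (tj \in Q)) => tQ; last first.
  have [w [w0 w1 wsup wspread]] := IH _ jd' sigma; exists w; split=> //.
    move=> s /wsup[h1 h2]; split.
      by move=> i iQ ij; apply: h1 => //; exact: ltnW.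
    move=> t tQ'; rewrite leq_eqVlt => /orP[/eqP e|]; last exact: h2.
    by case/negP: tQ; rewrite (_ : tj = t) //; exact: val_inj.
  move=> P s0 PQ; apply: wspread => i iP iQ; have := PQ i iP iQ.
  rewrite leq_eqVlt => /orP[/eqP e|//].
  by case/negP: tQ; rewrite (_ : tj = i) //; exact: val_inj.
pose sg c := (sigma * tperm (sigma tj) c)%g.
pose Qj := [set i in Q | (i < j)%N].
pose A := N tj sigma :\: sigma @: Qj.
have /boolp.choice[W HW] := fun c => IH _ jd' (sg c).
have cardA : kap^-1 <= #|A|%:R.
  have := Nbig tj sigma tQ; rewrite -lerBrDr => /le_trans; apply.
  rewrite lerBlDr -natrD ler_nat.
  have := cardsID (sigma @: Qj) (N tj sigma); rewrite -/A => <-.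
  rewrite addnC leq_add2l (leq_trans (subset_leq_card (finset.subsetIr _ _))) //.
  rewrite (leq_trans (leq_imset_card _ _)) //; apply: subset_leq_card.
  by apply/fintype.subsetP => i; rewrite inE => /andP[].
have A0 : 0 < #|A|%:R :> R by rewrite (lt_le_trans _ cardA) // invr_gt0.
have Ainv : #|A|%:R^-1 <= kap by rewrite -[kap]invrK lef_pV2 ?posrE ?invr_gt0.
have sgE c i : c \in A -> i \in Q -> (i < j)%N -> sg c i = sigma i.
  rewrite finset.in_setD => /andP[cQ _] iQ ij; rewrite permM tpermD //.
    by rewrite (inj_eq perm_inj); apply: contraTneq ij => <-; rewrite /= ltnn.
  by apply: contra cQ => /eqP ->; apply: imset_f; rewrite inE iQ.
have supp c s : c \in A -> W c s != 0 ->
    s tj = c /\ (forall i, i \in Q -> (i < j)%N -> s i = sigma i).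
  move=> cA; have [_ _ sup _] := HW c => /sup[h1 _]; split.
    by rewrite h1 //= permM tpermL.
  by move=> i iQ ij; rewrite h1 // ?sgE // (leq_trans ij).
exists (fun s => #|A|%:R^-1 * \sum_(c in A) W c s); split.
- move=> s; apply: mulr_ge0; first by rewrite invr_ge0 ltW.
  by apply: sumr_ge0 => c _; have [] := HW c.
- rewrite -mulr_sumr exchange_big /= (eq_bigr (fun=> 1)); last first.
    by move=> c _; have [] := HW c.
  by rewrite sumr_const -mulr_natr mul1r mulVf // gt_eqF.
- move=> s; rewrite mulf_eq0 negb_or => /andP[_ sn0].
  have [c cA cn0] : exists2 c, c \in A & W c s != 0.
    apply/exists_inP; apply: contraNT sn0 => /exists_inPn h.
    by rewrite big1 // => c /h; rewrite negbK => /eqP.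
  have [stj sq] := supp c s cA cn0; split=> // t tQ'.
  rewrite leq_eqVlt => /orP[/eqP e|jt]; last first.
    by have [_ _ sup _] := HW c; have [_] := sup s cn0; apply.
  have <- : tj = t by exact: val_inj.
  rewrite stj (Nloc _ s sigma) //.
  by move: cA; rewrite finset.in_setD => /andP[].
move=> P s0 PQ; rewrite -mulr_sumr exchange_big /=.
case: (boolP (tj \in P)) => tP.
  rewrite (cardsD1 tj P) tP add1n exprS.
  apply: ler_pM; [by rewrite invr_ge0 ltW| |exact: Ainv|].
    by apply: sumr_ge0 => c _; apply: sumr_ge0 => s _; have [] := HW c.
  have vanish c : c \in A -> c != s0 tj ->
      \sum_(s | agree_on P s0 s) W c s = 0.
    move=> cA cs0; apply: big1 => s /agree_onP ag; apply/eqP.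
    apply: contraNT cs0 => /(supp c s cA)[<- _].
    by rewrite ag.
  case: (boolP (s0 tj \in A)) => s0A; last first.
    rewrite big1 ?exprn_ge0 ?ltW // => c cA; apply: vanish => //.
    by apply: contraNneq s0A => <-.
  rewrite (bigD1 (s0 tj)) //= [X in _ + X]big1 ?addr0; last first.
    by move=> c /andP[]; exact: vanish.
  have [w0 _ _ wspread] := HW (s0 tj).
  apply: (@le_trans _ _ (\sum_(s | agree_on (P :\ tj) s0 s) W (s0 tj) s)).
    rewrite big_mkcond [leRHS]big_mkcond; apply: ler_sum => s _.
    case: ifP => [/agree_onP ag|_]; last by case: ifP.
    rewrite ifT //; apply/agree_onP => i; rewrite in_setD1 => /andP[_]; exact: ag.
  apply: wspread => i; rewrite in_setD1 => /andP[itj iP] iQ.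
  rewrite ltn_neqAle PQ // andbT; apply: contra itj => /eqP e.
  by apply/eqP; apply: val_inj.
rewrite mulrC ler_pdivrMr // mulr_natr -sumr_const; apply: ler_sum => c _.
have [_ _ _ wspread] := HW c; apply: wspread => i iP iQ.
rewrite ltn_neqAle PQ // andbT; apply: contraNneq tP => e.
by rewrite (_ : tj = i) //; exact: val_inj.
Qed.

(** With [kap] of the order of [1 / n], prescribing the values at the positions
of [P] costs as much as for a uniform permutation, up to a constant per
position, although the values at [Q] obey the constraints [N]. *)
Lemma random_bijection (R : realType) (n : nat) (Q : {set 'I_n})
    (N : 'I_n -> {perm 'I_n} -> {set 'I_n}) (kap : R) :
  (forall t (s s' : {perm 'I_n}), t \in Q ->
    (forall i, i \in Q -> (i < t)%N -> s i = s' i) -> N t s = N t s') ->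
  (forall t s, t \in Q -> kap^-1 + #|Q|%:R <= #|N t s|%:R) ->
  0 < kap -> expR 1 <= kap * (n - #|Q|)%:R ->
  exists w : {perm 'I_n} -> R,
    [/\ forall s, 0 <= w s, \sum_s w s = 1,
        forall s, w s != 0 -> forall t, t \in Q -> s t \in N t s &
        forall (P : {set 'I_n}) s0,
          \sum_(s | agree_on P s0 s) w s <= kap ^+ #|P|].
Proof.
move=> Nloc Nbig kap0 kapn.
have [w [w0 w1 wsup wspread]] :=
  random_bijection_stage Nloc Nbig kap0 kapn (add0n n) 1%g.
exists w; split=> // [s /wsup[_ h] t tQ|P s0]; first exact: h.
exact: wspread.
Qed.

(** * Density of sets of edges on a cycle *)

Lemma card_bigcup_le (T I : finType) (P : pred I) (F : I -> {set T}) :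
  (#|\bigcup_(i | P i) F i| <= \sum_(i | P i) #|F i|)%N.
Proof.
elim/big_rec2: _ => [|i m A _ Am]; first by rewrite cards0.
by rewrite (leq_trans (leq_card_setU _ _)) // leq_add2l.
Qed.

Definition preceding (n s : nat) (x : 'I_n) : {set 'I_n} :=
  [set iter t.+1 (@ord_pred n) x | t : 'I_s].

(** Shifted by one, so that a special position has at least [L - 1] positions
before it and its preceding window does not wrap around. *)
Definition special (L n : nat) (x : 'I_n) : bool := (L %| x.+1)%N.

Lemma val_iter_ord_pred (n : nat) (x : 'I_n) (t : nat) :
  (t <= x + n)%N -> iter t (@ord_pred n) x = ((x + n - t) %% n)%N :> nat.
Proof.
elim: t => [|t IH] tx; first by rewrite subn0 modnDr modn_small.
rewrite iterS /= IH; last exact: ltnW.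
have n0 : (0 < n)%N by apply: leq_trans (ltn_ord x).
have -> : ((x + n - t) %% n + n).-1 = ((x + n - t) %% n + n.-1)%N by lia.
rewrite modnDml; have -> : (x + n - t + n.-1 = x + n - t.+1 + n)%N by lia.
by rewrite modnDr.
Qed.

Lemma iter_ordSK (n t : nat) : cancel (iter t (@ordS n)) (iter t (@ord_pred n)).
Proof. by elim: t => // t IH x; rewrite iterSr iterS ordSK IH. Qed.

Lemma iter_ord_predK (n t : nat) :
  cancel (iter t (@ord_pred n)) (iter t (@ordS n)).
Proof. by elim: t => // t IH x; rewrite iterSr iterS ord_predK IH. Qed.

Lemma iter_ord_pred_surj (n : nat) (x y : 'I_n) :
  exists t, y = iter t (@ord_pred n) x.
Proof.
exists (x + n - y)%N; apply: ord_inj; rewrite val_iter_ord_pred ?leq_subr //.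
have yn := ltn_ord y; have -> : (x + n - (x + n - y) = y)%N by lia.
by rewrite modn_small.
Qed.

Lemma iter_ord_pred_iter_ordS (n : nat) (x : 'I_n) (a b : nat) :
  (a <= b)%N -> iter a (@ord_pred n) (iter b (@ordS n) x) = iter (b - a) (@ordS n) x.
Proof. by move=> ab; rewrite -{1}(subnKC ab) iterD iter_ordSK. Qed.

Lemma iter_ord_pred_iter_ordS_ge (n : nat) (x : 'I_n) (a b : nat) :
  (b <= a)%N ->
  iter a (@ord_pred n) (iter b (@ordS n) x) = iter (a - b) (@ord_pred n) x.
Proof. by move=> ba; rewrite -{1}(subnK ba) iterD iter_ordSK. Qed.

Lemma card_preceding (n s : nat) (x : 'I_n) : (#|preceding s x| <= s)%N.
Proof. by rewrite -[leqRHS]card_ord; exact: leq_imset_card. Qed.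

Lemma card_preceding_missing (n s : nat) (D : {set 'I_n}) (x : 'I_n) :
  (0 < s)%N -> ord_pred x \notin D -> (#|D :&: preceding s x| <= s.-1)%N.
Proof.
move=> s0 xD.
have : (#|D :&: preceding s x| < #|preceding s x|)%N.
  apply: proper_card; rewrite properE finset.subsetIr /=.
  apply/fintype.subsetPn; exists (ord_pred x).
    by apply/imsetP; exists (Ordinal s0).
  by rewrite finset.in_setI (negbTE xD).
by have := card_preceding s x; lia.
Qed.

Lemma special_within (n L : nat) (x : 'I_n) :
  (0 < L <= n)%N ->
  exists2 t, (t < 2 * L)%N & special L (iter t (@ord_pred n) x).
Proof.
move=> /andP[L0 Ln]; have xn := ltn_ord x.
have [xL|xL] := leqP L x.+1.
  have tL := ltn_pmod x.+1 L0.
  exists (x.+1 %% L)%N; first lia.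
  rewrite /special val_iter_ord_pred; last lia.
  have -> : (x + n - x.+1 %% L = x - x.+1 %% L + n)%N by lia.
  rewrite modnDr modn_small; last lia.
  have -> : ((x - x.+1 %% L).+1 = x.+1 %/ L * L)%N.
    by have := divn_eq x.+1 L; lia.
  exact: dvdn_mull.
have tL := ltn_pmod n L0.
exists (x.+1 + n %% L)%N; first lia.
rewrite /special val_iter_ord_pred; last lia.
rewrite modn_small; last lia.
have -> : ((x + n - (x.+1 + n %% L)).+1 = n %/ L * L)%N.
  by have := divn_eq n L; lia.
exact: dvdn_mull.
Qed.

(** Walking backwards from an element of [D], a special position comes up within
[2 * L] steps (not [L], because [L] need not divide [n]); so within that many
steps either one meets a special element of [D], or one leaves [D] at the start
of a run. *)
Lemma card_lossy (n L : nat) (D : {set 'I_n}) :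
  (0 < L <= n)%N ->
  (#|D| <= #|[set x in D | special L x || (ord_pred x \notin D)]| * (2 * L))%N.
Proof.
move=> Ln; set A := [set x in D | _].
have walk t : forall x, x \in D -> special L (iter t (@ord_pred n) x) ->
    exists2 u, (u <= t)%N & iter u (@ord_pred n) x \in A.
  elim: t => [|t IH] x xD; first by move=> sp; exists 0%N => //; rewrite inE xD; apply/orP; left.
  rewrite iterSr => sp; case: (boolP (ord_pred x \in D)) => pD.
    have [u ut uA] := IH _ pD sp; exists u.+1 => //; by rewrite iterSr.
  by exists 0%N => //; rewrite inE xD pD orbT.
have -> : (#|A| * (2 * L) = #|finset.setX A [set: 'I_(2 * L)]|)%N.
  by rewrite cardsX cardsT card_ord.
apply: leq_trans _ (leq_imset_card
  (fun z : 'I_n * 'I_(2 * L) => iter z.2 (@ordS n) z.1) _).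
apply: subset_leq_card; apply/fintype.subsetP => x xD.
have [t tL sp] := special_within x Ln.
have [u ut uA] := walk t x xD sp.
apply/imsetP; exists (iter u (@ord_pred n) x, Ordinal (leq_ltn_trans ut tL)).
  by rewrite inE uA inE.
by rewrite /= iter_ord_predK.
Qed.

(** Otherwise one could step back from any element of [D] to another one within
distance [s], and so go around the whole cycle; then every position would be
within distance [s] of [D]. *)
Lemma exists_isolated (n s : nat) (D : {set 'I_n}) :
  (0 < #|D|)%N -> (#|D| * s < n)%N ->
  exists2 x, x \in D & D :&: preceding s x = finset.set0.
Proof.
move=> /card_gt0P[x0 x0D] Dn.
have [/exists_inP[x xD /eqP xs]|/exists_inPn h] :=
  boolP [exists x in D, D :&: preceding s x == finset.set0]; first by exists x.
have pre x : x \in D -> exists2 t, (t < s)%N & iter t.+1 (@ord_pred n) x \in D.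
  move=> /h/set0Pn[y]; rewrite finset.in_setI => /andP[yD /imsetP[t _ yE]].
  by exists t => //; rewrite -yE.
suff : (n <= #|D| * s)%N by rewrite leqNgt Dn.
have -> : (#|D| * s = #|finset.setX D [set: 'I_s]|)%N by rewrite cardsX cardsT card_ord.
have s0 : (0 < s)%N by have [t] := pre _ x0D; case: (s).
rewrite -[leqLHS]card_ord.
apply: leq_trans _ (leq_imset_card
  (fun z : 'I_n * 'I_s => iter z.2 (@ordS n) z.1) _).
apply: subset_leq_card; apply/fintype.subsetP => y _.
have [j ->] := iter_ord_pred_surj x0 y.
have [t ts tD] : exists2 t, (t < s)%N &
    iter t (@ord_pred n) (iter j (@ord_pred n) x0) \in D.
  elim: j => [|j [t ts tD]]; first by exists 0%N.
  case: t ts tD => [|t] ts tD; last first.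
    by exists t; [exact: ltnW|rewrite iterS -iterSr].
  by have [u us uD] := pre _ tD; exists u => //; rewrite iterS -iterSr.
apply/imsetP; exists (iter t (@ord_pred n) (iter j (@ord_pred n) x0), Ordinal ts).
  by rewrite inE tD inE.
by rewrite /= iter_ord_predK.
Qed.

(** Take the first element [y] of [D] after the isolated element [x]: going back
from [y] one meets [x] and then the empty window before [x]. *)
Lemma exists_second (n s : nat) (D : {set 'I_n}) (x : 'I_n) :
  (1 < #|D|)%N -> x \in D -> D :&: preceding s x = finset.set0 ->
  exists2 y, y \in D :\ x & (#|D :&: preceding s y| <= 1)%N.
Proof.
move=> D1 xD iso.
have exS : exists t, iter t (@ordS n) x \in D :\ x.
  have /card_gt0P[y yD] : (0 < #|D :\ x|)%N by rewrite (cardsD1 x D) xD in D1.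
  have [t tE] := iter_ord_pred_surj y x.
  by exists t; rewrite tE iter_ord_predK -tE.
case: (ex_minnP exS) => t tD tmin; exists (iter t (@ordS n) x) => //.
rewrite -(cards1 x); apply: subset_leq_card; apply/fintype.subsetP => z.
rewrite finset.in_setI finset.in_set1 => /andP[zD /imsetP[u _ zE]].
have [ut|tu] := leqP u.+1 t.
  rewrite iter_ord_pred_iter_ordS // in zE.
  have := tmin (t - u.+1)%N; rewrite -zE in_setD1 zD andbT.
  by case: eqP => // _ /(_ isT); lia.
rewrite iter_ord_pred_iter_ordS_ge in zE; last exact: ltnW.
have lt : (u - t < s)%N by apply: leq_ltn_trans (ltn_ord u); exact: leq_subr.
have : z \in D :&: preceding s x.
  rewrite finset.in_setI zD; apply/imsetP; exists (Ordinal lt) => //.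
  by rewrite zE; congr iter => /=; lia.
by rewrite iso inE.
Qed.

Lemma bin_lt_pred (s k a : nat) :
  (2 <= k)%N -> (k - 1 <= s)%N -> (a <= s.-1)%N -> ('C(a, k - 1) < 'C(s, k - 1))%N.
Proof.
case: k => [|[|k]] // _; case: s => [|s]; first by rewrite subSS subn0.
rewrite subSS subn0 /= => ks as_; apply: (@leq_ltn_trans 'C(s, k.+1)).
  exact: leq_bin2l.
by rewrite binS -addn1 leq_add2l bin_gt0.
Qed.

Lemma card_edges_ending (n k s : nat) (D : {set 'I_n}) (F : {set {set 'I_n}})
    (x : 'I_n) :
  (0 < k)%N -> (forall f, f \in F -> #|f| = k /\ f \subset D) ->
  (#|[set f in F | (x \in f) && (f \subset x |: preceding s x)]|
     <= 'C(#|D :&: preceding s x|, k - 1))%N.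
Proof.
move=> k0 hF; rewrite -cards_draws; set A := [set f in F | _].
rewrite -(card_in_imset (f := fun f : {set 'I_n} => f :\ x) (D := A)); last first.
  move=> f g; rewrite !inE => /and3P[_ xf _] /and3P[_ xg _] e.
  by rewrite -(finset.setD1K xf) e finset.setD1K.
apply: subset_leq_card; apply/fintype.subsetP => _ /imsetP[f + ->].
rewrite [f \in A]inE => /and3P[fF xf fx]; have [fk fD] := hF f fF.
rewrite inE; apply/andP; split.
  apply/fintype.subsetP => y; rewrite in_setD1 => /andP[yx yf].
  rewrite finset.in_setI (fintype.subsetP fD) //=.
  by have := fintype.subsetP fx y yf; rewrite in_setU1 (negbTE yx).
by have := cardsD1 x f; rewrite fk xf => ->; rewrite add1n subn1.
Qed.

(** Every position ends at most [C] edges, and the lossy ones of [card_lossy] end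
at most [C - 1]. If [D] has more than [N] elements, this loss is larger than
[C + (#|D| - 1) / N]. If [D] is smaller, some element of [D] ends no edge, which
is a loss of [C], and the next one is preceded by at most one element of [D],
which loses [1] more because [1 <= s.-1]. *)
Lemma density_gap (n k s L : nat) (C := 'C(s, k - 1)) (N := (4 * L * C)%N)
    (D : {set 'I_n}) (F : {set {set 'I_n}}) :
  (2 <= k)%N -> (k - 1 <= s)%N -> (2 <= s)%N -> (0 < L <= n)%N ->
  (N * s < n)%N -> (1 < #|D|)%N ->
  (forall f, f \in F -> [/\ #|f| = k, f \subset D &
     exists x, [/\ x \in f, ~~ special L x & f \subset x |: preceding s x]]) ->
  (#|F| * N <= (N * C - 1) * (#|D| - 1))%N.
Proof.
move=> k2 ks s2 Ln nN D1 hF.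
have C0 : (0 < C)%N by rewrite bin_gt0.
have L0 : (0 < L)%N by case/andP: Ln.
pose Fx x := [set f in F | (x \in f) && (f \subset x |: preceding s x)].
(* The edges ending at x; by hypothesis each edge ends at some position that is
   not special. *)
pose a x := if special L x then 0%N else #|Fx x|.
have hF' f : f \in F -> #|f| = k /\ f \subset D by case/hF.
have aC x b : (#|D :&: preceding s x| <= b)%N -> (a x <= 'C(b, k - 1))%N.
  move=> Db; rewrite /a; case: ifP => // _.
  by apply: leq_trans (card_edges_ending s x (ltnW k2) hF') _; exact: leq_bin2l.
have ale x : (a x <= C)%N.
  apply: aC; apply: leq_trans (card_preceding s x).
  exact: subset_leq_card (finset.subsetIr _ _).
have Fsum : (#|F| <= \sum_(x in D) a x)%N.
  apply: (@leq_trans #|\bigcup_(x in D | ~~ special L x) Fx x|).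
    apply: subset_leq_card; apply/fintype.subsetP => f fF.
    have [_ fD [x [xf xs fx]]] := hF f fF.
    apply/bigcupP; exists x; last by rewrite inE fF xf.
    by rewrite (fintype.subsetP fD).
  apply: leq_trans (card_bigcup_le _ _) _.
  rewrite big_mkcondr /=; apply: leq_sum => x _; rewrite /a.
  by case: (special L x).
set v := #|D| in D1 *.
set A := [set x in D | special L x || (ord_pred x \notin D)].
have vA : (v <= #|A| * (2 * L))%N by exact: card_lossy.
have bigD : (#|F| + #|A| <= C * v)%N.
  apply: (@leq_trans (\sum_(x in D) (a x + (x \in A)))).
    rewrite big_split /= leq_add //.
    rewrite [leqRHS](bigID (mem A)) /= (leq_trans _ (leq_addr _ _)) //.
    rewrite -sum1_card big_mkcond [leqRHS]big_mkcond; apply: leq_sum => x _ /=.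
    by case: ifP => // xA; move: (xA); rewrite inE => /andP[-> _].
  rewrite mulnC -sum_nat_const; apply: leq_sum => x xD.
  case: (boolP (x \in A)) => xA /=; last by rewrite addn0.
  rewrite addn1; move: xA; rewrite inE xD /= => /orP[sx|px].
    by rewrite /a sx.
  apply: (leq_ltn_trans (aC x s.-1 _)); last exact: bin_lt_pred.
  by apply: card_preceding_missing => //; exact: ltnW.
(* Large sets: the lossy elements make up for the missing first one. *)
have [vN|Nv] := leqP v N; last first.
  have -> : ((N * C - 1) * (v - 1) = N * C * v + 1 - N * C - v)%N by nia.
  have h1 : (N * #|F| + N * #|A| <= N * C * v)%N.
    by rewrite -mulnDr -mulnA leq_mul2l bigD orbT.
  have h2 : (2 * C * v <= N * #|A|)%N.
    rewrite /N; have := leq_mul (leqnn (2 * C)%N) vA; lia.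
  have h3 : (C * N <= C * v)%N by rewrite leq_mul2l (ltnW Nv) orbT.
  have h4 : (v <= C * v)%N by rewrite leq_pmull.
  lia.
(* Small sets do not wrap around the cycle. *)
have [x xD iso] : exists2 x, x \in D & D :&: preceding s x = finset.set0.
  apply: exists_isolated; first exact: ltnW.
  by apply: leq_ltn_trans nN; rewrite leq_mul2r vN orbT.
have [y yD yle] := exists_second D1 xD iso.
have ax : a x = 0%N.
  apply/eqP; rewrite -leqn0; apply: leq_trans (aC x 0%N _) _.
    by rewrite iso cards0.
  by rewrite bin0n; case: (k) k2 => [|[|]].
have ay : (a y < C)%N.
  by apply: (leq_ltn_trans (aC y 1%N yle)); apply: bin_lt_pred => //; lia.
have small : (#|F| + C + 1 <= C * v)%N.
  have vE : v = (#|D :\ x :\ y|.+2)%N.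
    by rewrite /v (cardsD1 x D) xD (cardsD1 y (D :\ x)) yD.
  have : (\sum_(z in D :\ x :\ y) a z <= #|D :\ x :\ y| * C)%N.
    by rewrite -sum_nat_const; apply: leq_sum.
  move: Fsum; rewrite (big_setD1 x xD) /= (big_setD1 y yD) /= ax.
  have -> : (C * v = #|D :\ x :\ y| * C + C + C)%N by rewrite vE !mulnS mulnC; lia.
  move: ay; move: (a y) (\sum_(z in D :\ x :\ y) a z) (#|D :\ x :\ y| * C)%N.
  move: (#|F|) (C) => fF c ay S T; lia.
have -> : ((N * C - 1) * (v - 1) = N * C * v + 1 - N * C - v)%N by nia.
have : (N * #|F| + N * C + N <= N * C * v)%N.
  by rewrite -{3}[N]muln1 -!mulnDr -mulnA leq_mul2l small orbT.
lia.
Qed.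

(** * From vertex spread to edge spread *)

Definition placed (n : nat) (A : {set 'I_n}) (g : 'I_n -> 'I_n)
    (s : {perm 'I_n}) : bool :=
  [forall x in A, s (g x) == x].

Lemma placedP (n : nat) (A : {set 'I_n}) (g : 'I_n -> 'I_n) (s : {perm 'I_n}) :
  reflect (forall x, x \in A -> s (g x) = x) (placed A g s).
Proof. by apply: (iffP forall_inP) => h x xA; apply/eqP/h. Qed.

Lemma placed_mean (R : realType) (n : nat) (w : {perm 'I_n} -> R) (kap : R)
    (A : {set 'I_n}) (g : 'I_n -> 'I_n) :
  0 <= kap ->
  (forall (P : {set 'I_n}) s0, \sum_(s | agree_on P s0 s) w s <= kap ^+ #|P|) ->
  \sum_(s | placed A g s) w s <= kap ^+ #|A|.
Proof.
move=> kap0 spread; case: (pickP (placed A g)) => [s0 /placedP s0A|none]; last first.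
  by rewrite big_pred0 // exprn_ge0.
have ginj : {in A &, injective g}.
  by move=> x y xA yA e; rewrite -(s0A x xA) -(s0A y yA) e.
rewrite -(card_in_imset ginj); apply: le_trans (spread _ s0).
rewrite le_eqVlt; apply/orP; left; apply/eqP; apply: eq_bigl => s.
apply/placedP/agree_onP => [sA _ /imsetP[x xA ->]|sA x xA].
  by rewrite sA // s0A.
by rewrite sA ?s0A // imset_f.
Qed.

(** Reveal the positions of the vertices of the component [D] of [u] one at a
time, always choosing a neighbour of a vertex whose position is known, so that
it has at most [B] possible positions. *)
Lemma component_spread (R : realType) (n B : nat) (w : {perm 'I_n} -> R)
    (Om : {set {perm 'I_n}}) (Z : {perm 'I_n} -> {set {set 'I_n}})
    (nb : 'I_n -> {set 'I_n}) (S : {set {set 'I_n}}) (A D : {set 'I_n}) (b : R)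
    (e : rel 'I_n) (u : 'I_n) :
  (forall s, 0 <= w s) -> (forall x, (#|nb x| <= B)%N) ->
  (forall s x y, s \in Om -> S \subset Z s -> e x y ->
     (s^-1)%g y \in nb ((s^-1)%g x)) ->
  symmetric e -> (forall x, (x \in D) = connect e u x) ->
  (forall g, \sum_(s in Om | (S \subset Z s) && placed (A :|: D) g s) w s <= b) ->
  forall g,
  \sum_(s in Om | (S \subset Z s) && placed (A :|: [set u]) g s) w s
    <= B%:R ^+ (#|D| - 1) * b.
Proof.
move=> w0 nbB adj esym DE hb.
suff main d : forall C : {set 'I_n}, u \in C -> C \subset D ->
    (#|D| - #|C|)%N = d -> forall g,
    \sum_(s in Om | (S \subset Z s) && placed (A :|: C) g s) w s <= B%:R ^+ d * b.
  move=> g; apply: main; rewrite ?cards1 ?set11 //.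
  by rewrite finset.sub1set DE connect0.
elim: d => [|d IH] C uC CD Cd g.
  rewrite mul1r; have -> : C = D; last exact: hb.
  by apply/eqP; rewrite eqEcard CD -subn_eq0 Cd.
have [x xC [y [yD yC exy]]] : exists2 x, x \in C &
    exists y, [/\ y \in D, y \notin C & e x y].
  have [/exists_inP[x xC /exists_inP[y yD /andP[yC exy]]]|/exists_inPn h] :=
    boolP [exists x in C, exists y in D, (y \notin C) && e x y].
    by exists x => //; exists y.
  have step x y : e x y -> x \in C -> y \in C.
    move=> exy xC; have /exists_inPn := h x xC; move/(_ y).
    rewrite exy andbT negbK; apply; rewrite DE.
    by apply: connect_trans (connect1 exy); rewrite -DE (fintype.subsetP CD).
  have cl : closed_mem e (mem C).
    move=> x y exy; apply/idP/idP; first exact: step.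
    by apply: step; rewrite esym.
  have DC : D \subset C.
    by apply/fintype.subsetP => z; rewrite DE => /(closed_connect cl) <-.
  by have := subset_leq_card DC; rewrite -subn_eq0 Cd.
pose gy o z := if z == y then o else g z.
have Cy : (#|D| - #|y |: C|)%N = d.
  by rewrite cardsU1 yC; move: Cd; lia.
have CyD : y |: C \subset D by rewrite finset.subUset finset.sub1set yD.
have uCy : u \in y |: C by rewrite in_setU1 uC orbT.
apply: (@le_trans _ _ (\sum_(o in nb (g x)) \sum_(s in Om | (S \subset Z s)
    && placed (A :|: (y |: C)) (gy o) s) w s)).
  rewrite (exchange_big_dep (mem Om)) /=; last by move=> o s _ /andP[].
  rewrite [leLHS]big_mkcondr /=; apply: ler_sum => s sO.
  case: ifP => [/andP[SZ /placedP pl]|_]; last by apply: sumr_ge0.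
  have gxE : (s^-1)%g x = g x.
    by rewrite -{1}(pl x) ?permK // finset.in_setU xC orbT.
  have o0 : (s^-1)%g y \in nb (g x) by rewrite -gxE adj.
  rewrite (bigD1 ((s^-1)%g y)) /=; last first.
    rewrite o0 sO SZ; apply/placedP => z; rewrite /gy.
    case: eqVneq => [-> _|zy zA]; first by rewrite permKV.
    apply: pl; move: zA; rewrite !finset.in_setU finset.in_set1 (negbTE zy).
    by [].
  by rewrite lerDl sumr_ge0.
have b0 : 0 <= b by apply: le_trans (hb g); apply: sumr_ge0.
apply: (@le_trans _ _ (\sum_(o in nb (g x)) B%:R ^+ d * b)).
  by apply: ler_sum => o _; exact: IH.
rewrite sumr_const -[leLHS]mulr_natl exprS -mulrA; apply: ler_wpM2r.
  by rewrite mulr_ge0 ?exprn_ge0.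
by rewrite ler_nat.
Qed.

(** The component of [S] on a vertex set [D] can be placed in at most
[n * B ^ (#|D| - 1)] ways, and each vertex costs a factor [kap]; the last
hypothesis says that this amounts to at most [q] per edge of the component. The
components are peeled off one at a time, which is why the induction carries a
set [A] of vertices whose positions [g] are already known. *)
Lemma edge_spread (R : realType) (n B : nat) (w : {perm 'I_n} -> R)
    (Om : {set {perm 'I_n}}) (Z : {perm 'I_n} -> {set {set 'I_n}})
    (nb : 'I_n -> {set 'I_n}) (kap q : R) :
  (forall s, 0 <= w s) -> 0 <= kap -> 0 <= q ->
  (forall (P : {set 'I_n}) s0, \sum_(s | agree_on P s0 s) w s <= kap ^+ #|P|) ->
  (forall x, (#|nb x| <= B)%N) ->
  (forall s f x y, s \in Om -> f \in Z s -> x \in f -> y \in f ->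
     (s^-1)%g y \in nb ((s^-1)%g x)) ->
  (forall s f, s \in Om -> f \in Z s -> (1 < #|f|)%N) ->
  (forall s (D : {set 'I_n}) (F : {set {set 'I_n}}), s \in Om -> F \subset Z s ->
     (1 < #|D|)%N -> (forall f, f \in F -> f \subset D) ->
     n%:R * B%:R ^+ (#|D| - 1) * kap ^+ #|D| <= q ^+ #|F|) ->
  forall S : {set {set 'I_n}}, \sum_(s in Om | S \subset Z s) w s <= q ^+ #|S|.
Proof.
move=> w0 kap0 q0 spread nbB adj big2 gap.
suff main m : forall (S : {set {set 'I_n}}) (A : {set 'I_n}) g, (#|S| < m)%N ->
    (forall f, f \in S -> f :&: A = finset.set0) ->
    \sum_(s in Om | (S \subset Z s) && placed A g s) w s <= kap ^+ #|A| * q ^+ #|S|.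
  move=> S; have := main _ S finset.set0 id (ltnSn _).
  rewrite cards0 expr0 mul1r => h.
  apply: le_trans (h _) => [|f _]; last by rewrite finset.setI0.
  rewrite le_eqVlt; apply/orP; left; apply/eqP; apply: eq_bigl => s.
  have -> : placed finset.set0 id s by apply/placedP => x; rewrite inE.
  by rewrite andbT.
elim: m => // m IH S A g Sm SA.
have [S0|[e0 e0S]] := set_0Vmem S.
  rewrite S0 cards0 mulr1; apply: le_trans (placed_mean A g kap0 spread).
  rewrite big_mkcond [leRHS]big_mkcond; apply: ler_sum => s _.
  by case: ifP => [/and3P[_ _ ->]//|_]; case: ifP.
case: (pickP [pred s | (s \in Om) && (S \subset Z s)]) => [s1 /= /andP[s1O s1S]|none];
    last first.
  rewrite big_pred0 ?mulr_ge0 ?exprn_ge0 // => s.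
  by have /= := none s; rewrite andbA => ->.
have e1 : (1 < #|e0|)%N by apply: big2 s1O _; exact: (fintype.subsetP s1S).
have /card_gt0P[u ue] : (0 < #|e0|)%N by exact: ltnW.
pose r : rel 'I_n := fun x y => [exists f in S, (x \in f) && (y \in f)].
have rsym : symmetric r.
  by move=> x y; apply: eq_existsb => f; rewrite [(x \in f) && _]andbC.
pose D := [set y | connect r u y].
(* S2 is what remains of S after the component D of u has been removed. *)
pose S2 := [set f in S | f :&: D == finset.set0].
have uD : u \in D by rewrite inE connect0.
have FD f : f \in S :\: S2 -> f \subset D.
  rewrite finset.in_setD inE => /andP[+ fS]; rewrite fS /= => /set0Pn[x].
  rewrite finset.in_setI => /andP[xf xD]; apply/fintype.subsetP => y yf.
  rewrite inE; rewrite inE in xD; apply: connect_trans xD (connect1 _).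
  by apply/exists_inP; exists f => //; rewrite xf.
have e0F : e0 \in S :\: S2.
  rewrite finset.in_setD e0S andbT inE e0S /=; apply/set0Pn; exists u.
  by rewrite finset.in_setI ue uD.
have D1 : (1 < #|D|)%N by apply: leq_trans e1 (subset_leq_card (FD _ e0F)).
have S2S : S2 \subset S by apply/fintype.subsetP => f; rewrite inE => /andP[].
have cardS : #|S| = (#|S2| + #|S :\: S2|)%N.
  by rewrite -(cardsID S2 S) (finset.setIidPr S2S).
have S2m : (#|S2| < m)%N.
  rewrite (leq_trans _ (_ : #|S| <= m)%N) // cardS -addn1 leq_add2l.
  by apply/card_gt0P; exists e0.
have DA : A :&: D = finset.set0.
  have cl : closed_mem r (mem [pred x | [exists f in S, x \in f]]).
    move=> x y /exists_inP[f fS /andP[xf yf]]; rewrite !inE.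
    by apply/exists_inP/exists_inP => _; exists f.
  apply/eqP; rewrite -finset.subset0; apply/fintype.subsetP => y.
  rewrite finset.in_setI => /andP[yA yD].
  have : y \in [pred x | [exists f in S, x \in f]].
    rewrite inE in yD; rewrite -(closed_connect cl yD).
    by apply/exists_inP; exists e0.
  move/exists_inP => [f fS yf]; have /setP/(_ y) := SA f fS.
  by rewrite finset.in_setI yf yA !inE.
have cardAD : #|A :|: D| = (#|A| + #|D|)%N by rewrite cardsU DA cards0 subn0.
have base h : \sum_(s in Om | (S \subset Z s) && placed (A :|: D) h s) w s
    <= kap ^+ (#|A| + #|D|) * q ^+ #|S2|.
  rewrite -cardAD; apply: le_trans (IH S2 (A :|: D) h S2m _); last first.
    move=> f; rewrite inE => /andP[fS /eqP fD].
    by rewrite finset.setIUr fD SA // finset.setU0.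
  rewrite big_mkcond [leRHS]big_mkcond; apply: ler_sum => s _.
  case: ifP => [/and3P[-> SZ ->]|_]; last by case: ifP.
  by rewrite (fintype.subset_trans S2S SZ).
have comp := @component_spread R n B w Om Z nb S A D _ r u w0 nbB _ rsym _ base.
pose gu o z := if z == u then o else g z.
have uA : u \notin A.
  by apply/negP => uA; have /setP/(_ u) := DA; rewrite finset.in_setI uA uD inE.
apply: (@le_trans _ _ (\sum_(o : 'I_n) \sum_(s in Om | (S \subset Z s)
    && placed (A :|: [set u]) (gu o) s) w s)).
  rewrite (exchange_big_dep (mem Om)) /=; last by move=> o s _ /andP[].
  rewrite [leLHS]big_mkcondr /=; apply: ler_sum => s sO.
  case: ifP => [/andP[SZ /placedP pl]|_]; last by apply: sumr_ge0.
  rewrite (bigD1 ((s^-1)%g u)) /=; last first.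
    rewrite sO SZ; apply/placedP => z; rewrite /gu.
    case: eqVneq => [-> _|zu zA]; first by rewrite permKV.
    by apply: pl; move: zA; rewrite finset.in_setU finset.in_set1 (negbTE zu) orbF.
  by rewrite lerDl sumr_ge0.
apply: (@le_trans _ _ (\sum_(o : 'I_n)
    (B%:R ^+ (#|D| - 1) * (kap ^+ (#|A| + #|D|) * q ^+ #|S2|)))).
  apply: ler_sum => o _; apply: comp.
    move=> s x y sO SZ /exists_inP[f fS /andP[xf yf]].
    by apply: adj xf yf => //; exact: (fintype.subsetP SZ).
  by move=> x; rewrite inE.
rewrite sumr_const card_ord -[leLHS]mulr_natl cardS !exprD.
have -> : n%:R * (B%:R ^+ (#|D| - 1) * (kap ^+ #|A| * kap ^+ #|D| * q ^+ #|S2|)) =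
  kap ^+ #|A| * q ^+ #|S2| * (n%:R * B%:R ^+ (#|D| - 1) * kap ^+ #|D|).
  by move: (kap ^+ _) (kap ^+ _) (q ^+ _) (B%:R ^+ _) => a1 a2 a3 a4; ring.
rewrite [leRHS]mulrA; apply: ler_wpM2l; first by rewrite mulr_ge0 ?exprn_ge0.
apply: gap s1O _ D1 FD; exact: fintype.subset_trans (finset.subsetDl _ _) s1S.
Qed.

(** * Powers of tight cycles in a hypergraph with random edges *)

Definition common_neighbours (n k : nat) (H : {set {set 'I_n}})
    (X : {set 'I_n}) : {set 'I_n} :=
  [set v | [forall T : {set 'I_n},
              (T \subset X) && (#|T| == k - 1)%N ==> (v |: T \in H)]].

Lemma min_codegree_le (n k : nat) (H : {set {set 'I_n}}) (T : {set 'I_n}) :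
  #|T| = (k - 1)%N -> (min_codegree k H <= codegree H T)%N.
Proof.
move=> Tk; rewrite /min_codegree.
elim: (index_enum _) (mem_index_enum T) => // S l IH.
rewrite in_cons big_cons => /orP[/eqP <-|/IH Sl].
  by rewrite Tk subn1 eqxx geq_minl.
by case: ifP => // _; exact: leq_trans (geq_minr _ _) Sl.
Qed.

Lemma min_codegree_le_card (n k : nat) (H : {set {set 'I_n}}) :
  (min_codegree k H <= n)%N.
Proof.
rewrite /min_codegree card_ord; elim/big_rec: _ => // T m _ mn.
exact: leq_trans (geq_minr _ _) mn.
Qed.

(** Each of the at most [C] subsets of [X] of size [k - 1] excludes at most
[(C^-1 - alpha) * n] vertices. *)
Lemma card_common_neighbours (R : realType) (n k s : nat)
    (H : {set {set 'I_n}}) (X : {set 'I_n}) (C := 'C(s, k - 1)) (alpha : R) :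
  (0 < C)%N -> (#|X| <= s)%N ->
  (1 - C%:R^-1 + alpha) * n%:R <= (min_codegree k H)%:R ->
  C%:R * alpha * n%:R <= #|common_neighbours k H X|%:R.
Proof.
move=> C0 Xs deg; have CR : 0 < C%:R :> R by rewrite ltr0n.
set c := min_codegree k H in deg.
have cn : (c <= n)%N by exact: min_codegree_le_card.
have cover : (n <= #|common_neighbours k H X| + C * (n - c))%N.
  rewrite -[leqLHS]card_ord -(cardsC (common_neighbours k H X)) leq_add2l.
  pose bad (T : {set 'I_n}) := [set v | v |: T \notin H].
  apply: (@leq_trans #|\bigcup_(T : {set 'I_n} | (T \subset X) && (#|T| == k - 1)%N) bad T|).
    apply: subset_leq_card; apply/fintype.subsetP => v.
    rewrite !inE => /forallPn[T]; rewrite negb_imply => /andP[TX vT].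
    by apply/bigcupP; exists T => //; rewrite inE.
  apply: leq_trans (card_bigcup_le _ _) _.
  apply: (@leq_trans (\sum_(T : {set 'I_n} | (T \subset X) && (#|T| == k - 1)%N) (n - c))).
    apply: leq_sum => T /andP[_ /eqP Tk].
    have := min_codegree_le H Tk; rewrite -/c /codegree => cT.
    have -> : bad T = ~: [set v | v |: T \in H] by apply/setP => v; rewrite !inE.
    by rewrite cardsCs finset.setCK card_ord leq_sub2l.
  rewrite sum_nat_const leq_mul2r; apply/orP; right.
  apply: (@leq_trans 'C(#|X|, k - 1)); last exact: leq_bin2l.
  by rewrite -cards_draws leq_eqVlt; apply/orP; left; apply/eqP;
    apply: eq_card => T; rewrite !inE.
have : n%:R <= #|common_neighbours k H X|%:R + C%:R * (n%:R - c%:R) :> R.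
  by rewrite -natrB // -natrM -natrD ler_nat.
have : C%:R * ((1 - C%:R^-1 + alpha) * n%:R) <= C%:R * c%:R :> R.
  by rewrite ler_pM2l.
have -> : C%:R * ((1 - C%:R^-1 + alpha) * n%:R) =
  C%:R * n%:R - n%:R + C%:R * alpha * n%:R :> R.
  by field; rewrite gt_eqF.
lra.
Qed.

(** The positions that must be filled first, so that the preceding window of a
special position is known when its vertex is chosen. *)
Definition phase_one (n s L : nat) : {set 'I_n} :=
  \bigcup_(t : 'I_n | special L t) (t |: preceding s t).

Lemma card_special (n L : nat) :
  (0 < L)%N -> (#|[set t : 'I_n | special L t]| <= n %/ L)%N.
Proof.
move=> L0.
have lt (a : 'I_(n %/ L)) : ((a.+1 * L).-1 < n)%N.
  have := ltn_ord a; have := divn_eq n L; have := leq_mul (ltn_ord a) (leqnn L).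
  by rewrite -(ltn_predK (_ : 0 < a.+1 * L)%N) ?muln_gt0 //; lia.
rewrite -[leqRHS]card_ord -cardsT.
apply: leq_trans _ (leq_imset_card (fun a => Ordinal (lt a)) _).
apply: subset_leq_card; apply/fintype.subsetP => t.
rewrite inE /special => /dvdnP[a ta].
have a0 : (0 < a)%N by case: a ta.
have an : (a.-1 < n %/ L)%N.
  by rewrite prednK // leq_divRL // -ta.
apply/imsetP; exists (Ordinal an) => //; apply: val_inj => /=.
by rewrite prednK // -ta.
Qed.

Lemma card_phase_one (n s L : nat) :
  (0 < L)%N -> (#|phase_one n s L| <= s.+1 * (n %/ L))%N.
Proof.
move=> L0; apply: leq_trans (card_bigcup_le _ _) _.
apply: (@leq_trans (\sum_(t : 'I_n | special L t) s.+1)).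
  apply: leq_sum => t _; apply: leq_trans (leq_card_setU _ _) _.
  by rewrite cards1 add1n ltnS card_preceding.
rewrite sum_nat_const mulnC leq_mul2l /=; apply: leq_trans (card_special n L0).
by rewrite leq_eqVlt; apply/orP; left; apply/eqP; apply: eq_card => t; rewrite !inE.
Qed.

Lemma preceding_special_lt (n s L : nat) (t i : 'I_n) :
  (s < L)%N -> special L t -> i \in preceding s t -> (i < t)%N.
Proof.
move=> sL /(dvdn_leq (ltn0Sn _)) Lt /imsetP[u _ ->]; have := ltn_ord u.
have tn := ltn_ord t => us; rewrite val_iter_ord_pred; last lia.
have -> : (t + n - u.+1 = t - u.+1 + n)%N by lia.
by rewrite modnDr modn_small; lia.
Qed.

Definition cycle_power_edges (n k m : nat) (s : {perm 'I_n}) :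
    {set {set 'I_n}} :=
  [set e : {set 'I_n} | (#|e| == k) && [exists i : 'I_n, e \subset consecutive s m i]].

Lemma card_cycle_power_edges (n k m : nat) (s : {perm 'I_n}) :
  (#|cycle_power_edges k m s| <= n * 2 ^ m)%N.
Proof.
apply: (@leq_trans #|\bigcup_(i : 'I_n) powerset (consecutive s m i)|).
  apply: subset_leq_card; apply/fintype.subsetP => e.
  rewrite inE => /andP[_ /existsP[i ei]]; apply/bigcupP; exists i => //.
  by rewrite powersetE.
apply: leq_trans (card_bigcup_le _ _) _.
rewrite -[X in (_ <= X * _)%N]card_ord -sum_nat_const; apply: leq_sum => i _.
rewrite card_powerset leq_exp2l //.
by apply: leq_trans (leq_imset_card _ _) _; rewrite card_ord.
Qed.

(** The cyclic order has no largest element, but the last position of [f] inside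
a fixed window is well defined. *)
Lemma window_last (n s : nat) (f : {set 'I_n}) (i : 'I_n) :
  f != finset.set0 ->
  (forall x, x \in f -> exists2 t, (t < s.+1)%N & x = iter t (@ordS n) i) ->
  exists2 x, x \in f & f \subset x |: preceding s x.
Proof.
move=> /set0Pn[z zf] win; have [t0 t0s zE] := win z zf.
pose P (t : 'I_s.+1) := iter t (@ordS n) i \in f.
have P0 : P (Ordinal t0s) by rewrite /P /= -zE.
case: (arg_maxnP (fun t : 'I_s.+1 => t : nat) P0) => t Pt tmax.
exists (iter t (@ordS n) i) => //; apply/fintype.subsetP => y yf.
have [u us yE] := win y yf.
have ut : (u <= t)%N by apply: (tmax (Ordinal us)); rewrite /P /= -yE.
rewrite in_setU1; have [ute|ne] := eqVneq u (t : nat); first by rewrite yE ute eqxx.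
have lt : (u < t)%N by rewrite ltn_neqAle ne.
apply/orP; right; apply/imsetP.
have wlt : (t - u.+1 < s)%N by have := ltn_ord t; lia.
exists (Ordinal wlt) => //=; rewrite yE.
rewrite -iterS -subSn // subSS iter_ord_pred_iter_ordS ?leq_subr //.
by congr iter; lia.
Qed.

(** Contains all positions that share a window of [m] positions with [p]: step
back from [p] to the start of the window, and forward again. *)
Definition nearby (n m : nat) (p : 'I_n) : {set 'I_n} :=
  [set iter c.2 (@ordS n) (iter c.1 (@ord_pred n) p) | c : 'I_m * 'I_m].

Lemma card_nearby (n m : nat) (p : 'I_n) : (#|nearby m p| <= m * m)%N.
Proof.
rewrite /nearby; apply: leq_trans (leq_imset_card _ _) _.
by rewrite (leq_trans (max_card _)) // card_prod card_ord.
Qed.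

Lemma nearby_window (n m : nat) (s : {perm 'I_n}) (f : {set 'I_n})
    (i x y : 'I_n) :
  f \subset consecutive s m i -> x \in f -> y \in f ->
  (s^-1)%g y \in nearby m ((s^-1)%g x).
Proof.
move=> /fintype.subsetP fi xf yf.
have /imsetP[a _ ->] := fi x xf; have /imsetP[b _ ->] := fi y yf.
by rewrite !permK; apply/imsetP; exists (a, b); rewrite ?inE //= iter_ordSK.
Qed.

(** The edges of the cycle power that end at a special position lie in [H] by
[valid]; transported to positions by [s^-1], the missing edges satisfy the
hypotheses of [density_gap]. *)
Lemma missing_density (n k r L : nat) (H : {set {set 'I_n}}) (s : {perm 'I_n})
    (sz := (k + r - 2)%N) (C := 'C(sz, k - 1)) (N := (4 * L * C)%N)
    (D : {set 'I_n}) (F : {set {set 'I_n}}) :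
  (2 <= k)%N -> (1 <= r)%N -> (4 <= k + r)%N -> (0 < L <= n)%N ->
  (N * sz < n)%N ->
  (forall t, special L t ->
     s t \in common_neighbours k H (s @: preceding sz t)) ->
  F \subset cycle_power_edges k (k + r - 1) s :\: H ->
  (1 < #|D|)%N -> (forall f, f \in F -> f \subset D) ->
  (#|F| * N <= (N * C - 1) * (#|D| - 1))%N.
Proof.
move=> k2 r1 kr Ln nN valid FZ D1 FD.
have Dcard : #|(s^-1)%g @: D| = #|D| by rewrite card_imset //; exact: perm_inj.
have imK (f : {set 'I_n}) : s @: ((s^-1)%g @: f) = f.
  rewrite -imset_comp -[RHS]imset_id; apply: eq_imset => x /=; exact: permKV.
have Fcard : #|[set (s^-1)%g @: f | f : {set 'I_n} in F]| = #|F|.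
  rewrite card_in_imset // => f g _ _ e; by rewrite -(imK f) e imK.
rewrite -Dcard -Fcard; apply: density_gap; rewrite ?Dcard -?/sz //; try lia.
move=> _ /imsetP[f fF ->].
have := fintype.subsetP FZ f fF; rewrite finset.in_setD inE.
move=> /andP[fH /andP[/eqP fk /existsP[i fi]]].
split; first by rewrite card_imset //; exact: perm_inj.
  by apply: imsetS; exact: FD.
have f0 : (s^-1)%g @: f != finset.set0.
  by rewrite -card_gt0 card_imset; [rewrite fk; lia|exact: perm_inj].
have win x : x \in (s^-1)%g @: f ->
    exists2 t, (t < sz.+1)%N & x = iter t (@ordS n) i.
  move=> /imsetP[y yf ->]; have /imsetP[t _ ->] := fintype.subsetP fi y yf.
  by exists t; [have := ltn_ord t; rewrite /sz; lia|rewrite permK].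
have [x xf fx] := window_last f0 win.
exists x; split=> //; apply: contra fH => spx.
have := valid x spx; rewrite inE => /forallP/(_ (s @: (((s^-1)%g @: f) :\ x))).
have -> : s x |: s @: (((s^-1)%g @: f) :\ x) = f.
  by rewrite -imsetU1 finset.setD1K // imK.
move/implyP; apply; apply/andP; split.
  by apply: imsetS; rewrite finset.subDset.
rewrite card_imset; last exact: perm_inj.
have := cardsD1 x ((s^-1)%g @: f); rewrite xf card_imset; last exact: perm_inj.
by rewrite fk => ->; rewrite add1n subn1.
Qed.

(** The measure of [random_bijection], with the constraint that a special position
receives a common neighbour of the preceding vertices, makes the sets of missing
edges a spread family, to which [spread_cover] applies. In these hypotheses
[kap] is the cost of placing one vertex and [q] that of one missing edge. *)
Lemma perturbed_failure (R : realType) (n k r L t : nat)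
    (H : {set {set 'I_n}}) (alpha p q y kap : R)
    (sz := (k + r - 2)%N) (C := 'C(sz, k - 1)) (N := (4 * L * C)%N)
    (m := (k + r - 1)%N) :
  (2 <= k)%N -> (1 <= r)%N -> (4 <= k + r)%N -> (sz < L)%N -> (L <= n)%N ->
  (N * sz < n)%N ->
  (1 - C%:R^-1 + alpha) * n%:R <= (min_codegree k H)%:R ->
  0 < kap ->
  kap^-1 + (sz.+1 * (n %/ L))%:R <= C%:R * alpha * n%:R ->
  expR 1 <= kap * (n - sz.+1 * (n %/ L))%:R ->
  0 < p <= 1 -> 0 < q ->
  (forall v e, (2 <= v)%N -> (e * N <= (N * C - 1) * (v - 1))%N ->
     n%:R * (m * m)%:R ^+ (v - 1) * kap ^+ v <= q ^+ e) ->
  (0 < t)%N -> expR 1 * (t%:R * q / p) <= y -> (n * 2 ^ m)%:R * y ^+ t < 1 ->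
  bernoulli_mean [set e : {set 'I_n} | #|e| == k] p
    (fun G => (~~ has_tight_Hamilton_cycle_power k r (H :|: G))%:R)
  <= t%:R * (expR 1 * (t%:R * q / p) / y).
Proof.
move=> k2 r1 kr sL Ln nN deg kap0 big rest pp q0 qE t0 xy small.
have L0 : (0 < L)%N by exact: leq_ltn_trans sL.
have C0 : (0 < C)%N by rewrite bin_gt0 /sz; lia.
pose Q := phase_one n sz L.
have cQ : (#|Q| <= sz.+1 * (n %/ L))%N by exact: card_phase_one.
pose Nb (x : 'I_n) (s : {perm 'I_n}) := if special L x then
  common_neighbours k H (s @: preceding sz x) else [set: 'I_n].
have comm (X : {set 'I_n}) : (#|X| <= sz)%N ->
    C%:R * alpha * n%:R <= #|common_neighbours k H X|%:R.
  by move=> Xs; exact: card_common_neighbours.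
have [w [w0 w1 wsup wspread]] : exists w : {perm 'I_n} -> R,
    [/\ forall s, 0 <= w s, \sum_s w s = 1,
        forall s, w s != 0 -> forall x, x \in Q -> s x \in Nb x s &
        forall (P : {set 'I_n}) s0,
          \sum_(s | agree_on P s0 s) w s <= kap ^+ #|P|].
  apply: random_bijection => //.
  - move=> x s s' xQ ss'; rewrite /Nb; case: ifP => // spx.
    congr common_neighbours; apply: eq_in_imset => i ix; apply: ss'.
      by apply/bigcupP; exists x => //; rewrite in_setU1 ix orbT.
    exact: (preceding_special_lt sL spx ix).
  - move=> x s xQ; apply: (@le_trans _ _ (C%:R * alpha * n%:R)).
      by apply: le_trans big; rewrite lerD2l ler_nat.
    rewrite /Nb; case: ifP => _.
      apply: comm; apply: leq_trans (leq_imset_card _ _) _; exact: card_preceding.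
    rewrite cardsT card_ord; apply: le_trans (comm finset.set0 _) _.
      by rewrite cards0.
    by rewrite ler_nat -[leqRHS]card_ord max_card.
  apply: le_trans rest _; rewrite ler_pM2l // ler_nat; exact: leq_sub2l.
pose Om := [set s | w s != 0].
pose Z s := cycle_power_edges k m s :\: H.
have valid s x : s \in Om -> special L x ->
    s x \in common_neighbours k H (s @: preceding sz x).
  rewrite inE => /wsup wv spx; have := wv x; rewrite /Nb spx; apply.
  by apply/bigcupP; exists x => //; rewrite setU11.
have espread := @edge_spread R n (m * m) w Om Z (@nearby n m) kap q w0 (ltW kap0)
  (ltW q0) wspread (@card_nearby n m).
have fail : bernoulli_mean [set e : {set 'I_n} | #|e| == k] p
    (fun G => [forall s in Om, ~~ (Z s \subset G)]%:R)
  <= t%:R * (expR 1 * (t%:R * q / p) / y).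
  apply: (@spread_cover R _ _ _ w p q y t Om Z (n * 2 ^ m)%:R) => //.
  - rewrite -w1 [LHS]big_mkcond; apply: eq_bigr => s _; rewrite inE.
    by case: eqP.
  - move=> s _; apply/fintype.subsetP => e; rewrite finset.in_setD !inE.
    by case/and3P.
  - move=> s _; rewrite ler_nat; apply: leq_trans (card_cycle_power_edges k m s).
    exact: subset_leq_card (finset.subsetDl _ _).
  apply: espread.
  - move=> s f x z _; rewrite finset.in_setD inE => /and3P[_ _ /existsP[i fi]].
    exact: (nearby_window fi).
  - move=> s f _; rewrite finset.in_setD inE => /and3P[_ /eqP -> _]; lia.
  move=> s D F sO FZ D1 FD; apply: qE => //.
  apply: missing_density FZ D1 FD => //; first by rewrite L0.
  by move=> x; exact: valid.
apply: le_trans fail; apply: bernoulli_mean_le => [|G _].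
  by case/andP: pp => p0 ->; rewrite ltW.
rewrite ler_nat; case E : has_tight_Hamilton_cycle_power => //=.
rewrite lt0b; apply/forall_inP => s sO; apply/negP => ZG.
move/negbT/existsPn: E => /(_ (cycle_power_edges k m s)) /negP; apply.
apply/andP; split; first by apply/existsP; exists s.
apply/fintype.subsetP => e eZ; rewrite finset.in_setU.
by case: (boolP (e \in H)) => //= eH; apply: (fintype.subsetP ZG);
  rewrite finset.in_setD eH.
Qed.

(** * The limit *)

Lemma binomial_kgraph_prob_mean (R : realType) (V : finType) (k : nat) (p : R)
    (A : pred {set {set V}}) :
  binomial_kgraph_prob k p A =
  1 - bernoulli_mean [set e : {set V} | #|e| == k] p (fun G => (~~ A G)%:R).
Proof.
set D := [set e : {set V} | #|e| == k].
have kD (G : {set {set V}}) : kgraph k G = (G \subset D).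
  apply/forall_inP/fintype.subsetP => h e eG; first by rewrite inE h.
  by have := h e eG; rewrite inE.
rewrite -[X in X - _](bernoulli_mean_cst D p) -[- _]mulN1r -bernoulli_meanZ.
rewrite -bernoulli_meanD /binomial_kgraph_prob /bernoulli_mean big_mkcond.
rewrite [RHS]big_mkcond; apply: eq_bigr => G _; rewrite kD.
case: (G \subset D) => //=; case: (A G) => /=; rewrite ?mulr0 ?addr0 ?mulr1.
  by apply: eq_bigl => e; rewrite inE.
by rewrite subrr mulr0.
Qed.

(** With [z = B * K ^ 2 / n <= 1] the left-hand side is at most [z ^ (v - 1)], and
the density gap says [e * N / (N * C - 1) <= v - 1]. *)
Lemma placement_le (R : realType) (n B N C v e : nat) (K : R) :
  (0 < n)%N -> (0 < B)%N -> 1 <= K -> (1 < N * C)%N ->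
  B%:R * K ^+ 2 <= n%:R ->
  (2 <= v)%N -> (e * N <= (N * C - 1) * (v - 1))%N ->
  n%:R * B%:R ^+ (v - 1) * (K / n%:R) ^+ v
  <= ((B%:R * K ^+ 2 / n%:R) `^ (N%:R / (N * C - 1)%:R)) ^+ e.
Proof.
move=> n0 B0 K1 NC zn v2 eN.
have nR : 0 < n%:R :> R by rewrite ltr0n.
have BR : 0 < B%:R :> R by rewrite ltr0n.
have K0 : 0 < K by apply: lt_le_trans K1.
have M0 : 0 < (N * C - 1)%:R :> R by rewrite ltr0n subn_gt0.
set z := B%:R * K ^+ 2 / n%:R.
have z0 : 0 < z by rewrite divr_gt0 // mulr_gt0 // exprn_gt0.
have z1 : z <= 1 by rewrite ler_pdivrMr // mul1r.
case: v v2 eN => [|[|v]] // _ eN.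
have vE : (v.+2 - 1 = v.+1)%N by rewrite subn1.
rewrite {}vE in eN *.
apply: (@le_trans _ _ (z ^+ v.+1)).
  have -> : n%:R * B%:R ^+ v.+1 * (K / n%:R) ^+ v.+2 =
      K * (B%:R * K / n%:R) ^+ v.+1.
    rewrite [(K / _) ^+ _]exprS -[B%:R * K / _]mulrA [in RHS]exprMn.
    move: (B%:R ^+ _) ((K / n%:R) ^+ _) => b c; field; exact: lt0r_neq0.
  have -> : z ^+ v.+1 = K ^+ v.+1 * (B%:R * K / n%:R) ^+ v.+1.
    by rewrite -exprMn; congr (_ ^+ _); rewrite /z expr2; ring.
  apply: ler_wpM2r; first by rewrite exprn_ge0 // divr_ge0 ?mulr_ge0 ?ltW.
  by rewrite -[leLHS]expr1; apply: ler_weXn2l.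
rewrite -[leRHS]powR_mulrn ?powR_ge0 // -powRrM -powR_mulrn; last exact: ltW.
apply: ger_powR; first by rewrite z0.
by rewrite mulrAC ler_pdivrMr // -!natrM ler_nat mulnC [leqRHS]mulnC.
Qed.

Local Open Scope classical_set_scope.

Lemma powR_eventually_ge (R : realType) (a M : R) :
  0 < a -> \forall n \near \oo, M <= n%:R `^ a.
Proof.
move=> a0; pose b := Num.max M 0.
have b0 : 0 <= b by rewrite le_max lexx orbT.
near=> n; apply: (@le_trans _ _ b); first by rewrite le_max lexx.
have -> : b = (b `^ a^-1) `^ a by rewrite -powRrM mulVf ?gt_eqF // powRr1.
apply: ge0_ler_powR; rewrite ?nnegrE ?powR_ge0 ?(ltW a0) //.
near: n; exact: nbhs_infty_ger.
Unshelve. all: by end_near. Qed.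

Theorem theorem1p3 (R : realType) (k r : nat) (hk : (2 <= k)%N)
    (hr : (1 <= r)%N) (hkr : (4 <= k + r)%N) (alpha : R) (halpha : 0 < alpha) :
  exists2 eps : R, 0 < eps &
    forall (H : forall n : nat, {set {set 'I_n}}) (p : nat -> R),
      (forall n : nat, kgraph k (H n)) ->
      (forall n : nat, 0 <= p n <= 1) ->
      (\forall n \near \oo,
         (1 - ('C(k + r - 2, k - 1)%:R)^-1 + alpha) * n%:R
           <= (min_codegree k (H n))%:R) ->
      (\forall n \near \oo,
         n%:R `^ (- ('C(k + r - 2, k - 1)%:R)^-1 - eps) <= p n) ->
      binomial_kgraph_prob k (p n)
        (fun G => has_tight_Hamilton_cycle_power k r (H n :|: G))
        @[n --> \oo] --> (1 : R).
Proof.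
pose sz := (k + r - 2)%N; pose C := 'C(sz, k - 1).
have C0 : (0 < C)%N by rewrite bin_gt0 /sz; lia.
have CR : 0 < C%:R :> R by rewrite ltr0n.
pose beta := C%:R * alpha; have beta0 : 0 < beta by rewrite mulr_gt0.
(* L is so large that the first phase uses at most half of the vertices, and at
   most half of the common neighbours of any window. *)
pose L := Num.bound (2 * sz.+1%:R * (1 + beta^-1)).
have szR : 0 < sz.+1%:R :> R by rewrite ltr0n.
have LR : 2 * sz.+1%:R * (1 + beta^-1) < L%:R.
  apply: archi_boundP; apply: mulr_ge0; first exact: mulr_ge0 (ltW szR).
  by rewrite addr_ge0 // invr_ge0 ltW.
have L1 : 2 * sz.+1%:R <= L%:R :> R.
  apply: le_trans (ltW LR); rewrite ler_peMr ?mulr_ge0 ?(ltW szR) //.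
  by rewrite lerDl invr_ge0 ltW.
have L2 : 2 * sz.+1%:R / beta <= L%:R :> R.
  apply: le_trans (ltW LR); apply: ler_wpM2l; first by rewrite mulr_ge0 ?(ltW szR).
  by rewrite lerDr.
have szL : (sz < L)%N by move: L1; rewrite -natrM ler_nat; lia.
have L0 : (0 < L)%N by exact: leq_ltn_trans szL.
pose N := (4 * L * C)%N; pose m := (k + r - 1)%N.
have NC1 : (1 < N * C)%N by rewrite /N; nia.
have NR : 0 < N%:R :> R by rewrite ltr0n /N; nia.
have MR : 0 < (N * C - 1)%:R :> R by rewrite ltr0n subn_gt0.
pose e1 : R := expR 1; have e0 : 1 <= e1 by rewrite -[leLHS]expR0 ler_expR.
(* The first summand accounts for a choice among beta * n / 2 vertices, the
   second one for the uniform choices among at least n / 2 vertices. *)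
pose K := 2 / beta + 2 * e1.
have ib0 : 0 < 2 / beta by rewrite divr_gt0.
have K1 : 1 <= K by rewrite /K; lra.
have K0 : 0 < K by exact: lt_le_trans K1.
pose B := (m * m)%N.
have B0 : (0 < B)%N by rewrite muln_gt0 /m; lia.
have BR : 0 < B%:R :> R by rewrite ltr0n.
pose K' := B%:R * K ^+ 2; have K'0 : 0 < K' by rewrite mulr_gt0 ?exprn_gt0.
(* A missing edge costs q = (K' / n) `^ a. The exponent a exceeds 1 / C by
   4 * eps: one eps is given away in p, one in the shrinking factor
   y = n `^ (- eps), and 2 * eps remain for the error term. *)
pose a : R := N%:R / (N * C - 1)%:R.
pose eps : R := (4 * C%:R * (N * C - 1)%:R)^-1.
have eps0 : 0 < eps by rewrite invr_gt0 !mulr_gt0.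
have aE : a = C%:R^-1 + 4 * eps.
  have ME : (N * C - 1)%:R = N%:R * C%:R - 1 :> R by rewrite natrB ?natrM // ltnW.
  rewrite /a /eps ME; field; rewrite -ME !gt_eqF //.
(* Number of rounds: y ^+ t <= n ^- 2 beats the number of edges, which is
   linear in n. *)
pose t := (Num.bound (2 / eps)).+1.
have tR : 2 <= eps * t%:R.
  rewrite mulrC -ler_pdivrMr // (le_trans (ltW (archi_boundP _))) //.
    by rewrite divr_ge0 // ltW.
  by rewrite ler_nat.
have t0 : 0 < t%:R :> R by rewrite ltr0n.
pose c := e1 * (t%:R * K' `^ a).
have c0 : 0 < c by rewrite !mulr_gt0 ?powR_gt0 // (lt_le_trans _ e0).
exists eps => // H p Hk p01 deg plow.
pose fail n : R := bernoulli_mean [set e : {set 'I_n} | #|e| == k]%SET (p n)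
  (fun G => (~~ has_tight_Hamilton_cycle_power k r (H n :|: G))%:R).
have bound : \forall n \near \oo,
    fail n <= t%:R * (c * n%:R `^ (- (2 * eps))).
  near=> n.
  have n0 : (0 < n)%N by near: n; exact: nbhs_infty_gt.
  have nR : 0 < n%:R :> R by rewrite ltr0n.
  have nL : (L <= n)%N by near: n; exact: nbhs_infty_ge.
  have nN : (N * sz < n)%N by near: n; exact: nbhs_infty_gt.
  have n2 : (2 ^ m < n)%N by near: n; exact: nbhs_infty_gt.
  have nK : K' <= n%:R by near: n; exact: nbhs_infty_ger.
  have nc : c <= n%:R `^ (2 * eps).
    by near: n; apply: powR_eventually_ge; rewrite mulr_gt0.
  have n1 : 1 <= n%:R :> R by rewrite ler1n.
  have degn : (1 - C%:R^-1 + alpha) * n%:R <= (min_codegree k (H n))%:R.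
    by near: n; exact: deg.
  have p0p : n%:R `^ (- C%:R^-1 - eps) <= p n by near: n; exact: plow.
  pose p0 := n%:R `^ (- C%:R^-1 - eps) : R; rewrite -/p0 in p0p.
  have p00 : 0 < p0 by rewrite powR_gt0.
  have pn1 : p n <= 1 by case/andP: (p01 n).
  pose y := n%:R `^ (- eps) : R; have y0 : 0 < y by rewrite powR_gt0.
  pose q := (K' / n%:R) `^ a; have q0 : 0 < q by rewrite powR_gt0 // divr_gt0.
  pose kap := K / n%:R; have kap0 : 0 < kap by rewrite divr_gt0.
  have powD u v : n%:R `^ (u + v) = n%:R `^ u * n%:R `^ v :> R.
    by rewrite powRD // (gt_eqF nR) implybT.
  have xE : e1 * (t%:R * q / p0) = c * n%:R `^ (- (3 * eps)).
    rewrite /q /p0 powRM ?invr_ge0 ?(ltW K'0) ?(ltW nR) //.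
    rewrite -[n%:R^-1]powR_inv1 ?(ltW nR) // -powRrM -powRN.
    rewrite /c -!mulrA -powD.
    by congr (_ * (_ * (_ * _ `^ _))); rewrite aE; ring.
  have usedR : (sz.+1 * (n %/ L))%:R <= sz.+1%:R * n%:R / L%:R :> R.
    rewrite ler_pdivlMr ?ltr0n // -!natrM ler_nat -mulnA leq_mul2l /=.
    exact: leq_trunc_div.
  have LR0 : 0 < L%:R :> R by rewrite ltr0n.
  have used1 : (sz.+1 * (n %/ L))%:R <= n%:R / 2 :> R.
    apply: le_trans usedR _; rewrite ler_pdivrMr //.
    have := ler_wpM2l (ltW nR) L1; lra.
  have used2 : (sz.+1 * (n %/ L))%:R <= beta * n%:R / 2 :> R.
    apply: le_trans usedR _; rewrite ler_pdivrMr //.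
    move: L2; rewrite ler_pdivrMr // => L2'.
    have := ler_wpM2l (ltW nR) L2'; nra.
  have used_n : (sz.+1 * (n %/ L) <= n)%N.
    by rewrite -(ler_nat R); apply: le_trans used1 _; lra.
  have main : bernoulli_mean [set e : {set 'I_n} | #|e| == k]%SET p0
     (fun G => (~~ has_tight_Hamilton_cycle_power k r (H n :|: G))%:R)
     <= t%:R * (e1 * (t%:R * q / p0) / y).
    apply: (perturbed_failure (L := L) (alpha := alpha) (kap := kap)) => //.
    - have kinv : kap^-1 <= beta * n%:R / 2.
        rewrite /kap invf_div ler_pdivrMr //.
        have -> : beta * n%:R / 2 * K = n%:R + n%:R * (beta * e1).
          by rewrite /K; field; rewrite gt_eqF.
        rewrite lerDl; apply: mulr_ge0; first exact: ltW.
        by apply: mulr_ge0; [exact: ltW|exact: le_trans e0].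
      rewrite -/sz -/C -/beta; lra.
    - rewrite -/sz natrB // -/e1.
      have half : n%:R / 2 <= n%:R - (sz.+1 * (n %/ L))%:R :> R by lra.
      apply: le_trans (ler_wpM2l (ltW kap0) half).
      have -> : kap * (n%:R / 2) = K / 2.
        by rewrite /kap; field; rewrite gt_eqF.
      rewrite /K; lra.
    - by rewrite p00 (le_trans p0p).
    - by move=> v e v2 eN; exact: placement_le.
    - rewrite -/e1 xE /y.
      have -> : - eps = 2 * eps + - (3 * eps) by ring.
      by rewrite powD; apply: ler_wpM2r.
    rewrite -/m /y -powR_mulrn ?powR_ge0 // -powRrM.
    apply: (@le_lt_trans _ _ ((n * 2 ^ m)%:R * n%:R `^ (- 2%:R))).
      apply: ler_wpM2l => //; apply: ler_powR => //; rewrite mulNr lerN2.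
      by [].
    rewrite powR_invn ?(ltW nR) // natrM mulrAC expr2 invfM mulrA divff ?gt_eqF //.
    by rewrite mul1r mulrC ltr_pdivrMr // mul1r ltr_nat.
  apply: (@le_trans _ _ (t%:R * (e1 * (t%:R * q / p0) / y))).
    apply: le_trans main; apply: bernoulli_mean_mono => //.
      by rewrite (ltW p00).
    move=> G G' sub; rewrite ler_nat.
    case E : (has_tight_Hamilton_cycle_power k r (H n :|: G)) => /=; last first.
      exact: leq_b1.
    move/existsP: E => [Cy /andP[CyP CyG]].
    rewrite (_ : has_tight_Hamilton_cycle_power _ _ _) //.
    apply/existsP; exists Cy; rewrite CyP /=.
    exact: fintype.subset_trans CyG (finset.setUS _ sub).
  rewrite xE /y -powRN opprK -mulrA -powD.
  by rewrite (_ : - (3 * eps) + eps = - (2 * eps)) //; ring.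
apply/cvgrPdist_le => d d0; near=> n.
have n0 : (0 < n)%N by near: n; exact: nbhs_infty_gt.
have nR : 0 < n%:R :> R by rewrite ltr0n.
rewrite binomial_kgraph_prob_mean opprB addrCA subrr addr0.
have fail0 : 0 <= fail n.
  apply: sumr_ge0 => G _; apply: mulr_ge0 => //; exact: bernoulli_weight_ge0.
rewrite ger0_norm //; apply: (@le_trans _ _ (t%:R * (c * n%:R `^ (- (2 * eps))))).
  by near: n; exact: bound.
have big : t%:R * c / d <= n%:R `^ (2 * eps).
  by near: n; apply: powR_eventually_ge; rewrite mulr_gt0.
rewrite powRN mulrA ler_pdivrMr ?powR_gt0 //.
by move: big; rewrite ler_pdivrMr // [leRHS]mulrC.
Unshelve. all: by end_near. Qed.
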